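(* Let $m,n\in\mathbb{N}$ and let $\vec{P}=(p_1,\ldots,p_m)$ with $p_1,\ldots,p_m\in(1,\infty)$ and $\frac1p=\frac1{p_1}+\cdots+\frac1{p_m}$. Assume that $1<p\le p_0<\frac{n}{\alpha}$ and $0<\beta<\alpha<mn$. Set $\theta=\frac{n-\beta p_0}{n-\alpha p_0}$, $q=\theta p$ and $q_0=\theta p_0$. Then there is a constant $C>0$, depending only on $n,m,\alpha,\beta,\vec{P},p_0$, such that for every nonnegative Radon measure $\mu$ on $\mathbb{R}^n$ and every $\vec{f}=(f_1,\ldots,f_m)\in\mathcal{M}^{\vec{P},p_0}((\mathbb{R}^n)^m)$, \[ \|\mathfrak{I}_\alpha(\vec{f})\|_{\mathcal{M}_{\mu}^{q,q_0}(\mathbb{R}^n)} \le C\, \|\mu\|_{n-\beta p}^{1/q}\, \|\vec{f}\|_{\mathcal{M}^{\vec{P},p_0}((\mathbb{R}^n)^m)}. \]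
   Context: $\mathcal{Q}$ denotes the family of all cubes in $\mathbb{R}^n$ with sides parallel to the coordinate axes; $|Q|$ is the volume of $Q$ and $\ell_Q=|Q|^{1/n}$ its side length. For $\vec{f}=(f_1,\ldots,f_m)$ with each $f_j$ locally integrable on $\mathbb{R}^n$, the $m$-linear fractional integral operator $\mathfrak{I}_\alpha$, $0<\alpha<mn$, is \[ \mathfrak{I}_\alpha(\vec{f})(x)=\int_{(\mathbb{R}^n)^m}\frac{\prod_{j=1}^m f_j(y_j)}{(|x-y_1|+\cdots+|x-y_m|)^{mn-\alpha}}\,dy_1\cdots dy_m,\qquad x\in\mathbb{R}^n. \] For a nonnegative Radon measure $\mu$ on $\mathbb{R}^n$ and $\gamma\in(0,n]$, $\|\mu\|_\gamma=\sup_{Q\in\mathcal{Q}}\mu(Q)/\ell_Q^{\gamma}$ (possibly $+\infty$). For $0<p\le p_0<\infty$ with $1/p=1/p_1+\cdots+1/p_m$, the product Morrey space $\mathcal{M}^{\vec{P},p_0}((\mathbb{R}^n)^m)$ is the set of all $\vec{f}=(f_1,\ldots,f_m)$ (each $f_j$ locally integrable on $\mathbb{R}^n$) with \[ \|\vec{f}\|_{\mathcal{M}^{\vec{P},p_0}((\mathbb{R}^n)^m)}=\sup_{Q\in\mathcal{Q}}|Q|^{1/p_0}\prod_{j=1}^m\left(\frac1{|Q|}\int_Q|f_j(y)|^{p_j}\,dy\right)^{1/p_j}<\infty. \] For $0<q\le q_0<\infty$, the Radon-Morrey space $\mathcal{M}_\mu^{q,q_0}(\mathbb{R}^n)$ consists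 of all $\mu$-measurable functions $g$ on $\mathbb{R}^n$ with \[ \|g\|_{\mathcal{M}_\mu^{q,q_0}(\mathbb{R}^n)}=\sup_{Q\in\mathcal{Q}}|Q|^{1/q_0-1/q}\left(\int_Q|g|^q\,d\mu\right)^{1/q}<\infty. \] *)

(* Defs.v *)
From HB Require Import structures.
From mathcomp Require Import all_boot all_order all_algebra.
From mathcomp Require Import all_classical all_reals all_analysis.
From mathcomp Require Import measurable_realfun.

Set Implicit Arguments.
Unset Strict Implicit.
Unset Printing Implicit Defensive.

Import Order.TTheory GRing.Theory Num.Theory.
Import numFieldNormedType.Exports.

Local Open Scope classical_set_scope.
Local Open Scope ring_scope.
Local Open Scope ereal_scope.

(* The k-fold product of a sigma-finite measure, on k-tuples with the product
   sigma-algebra: a Dirac mass on 0-tuples, and the image of [mu \x mu^k] under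
   (t, s) |-> t :: s on k.+1-tuples. *)
Section tuple_measure.
Context {d : measure_display} {T : measurableType d} {R : realType}.

Definition pair_cons (k : nat) (x : T * k.-tuple T) : k.+1.-tuple T :=
  [tuple of x.1 :: x.2].

Lemma measurable_pair_cons k : measurable_fun [set: T * k.-tuple T] (@pair_cons k).
Proof. exact: measurable_cons. Qed.

Section step.
Variables (mu : {sigma_finite_measure set T -> \bar R}) (k : nat).
Variable nu : {sigma_finite_measure set (k.-tuple T) -> \bar R}.

Definition cons_measure : set (k.+1.-tuple T) -> \bar R :=
  pushforward (mu \x nu) (@pair_cons k).

Let cons_measure0 : cons_measure set0 = 0.
Proof. by rewrite /cons_measure /pushforward preimage_set0 measure0. Qed.

Let cons_measure_ge0 A : 0 <= cons_measure A.
Proof. exact: (measure_ge0 (mu \x nu)). Qed.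

Let cons_measure_sigma_additive : semi_sigma_additive cons_measure.
Proof.
move=> F mF tF mUF; rewrite /cons_measure /pushforward preimage_bigcup.
apply: measure_semi_sigma_additive.
- by move=> i; rewrite -[X in measurable X]setTI; exact: measurable_pair_cons.
- apply/trivIsetP => /= i j _ _ ij; rewrite -preimage_setI.
  by move/trivIsetP : tF => /(_ _ _ _ _ ij) ->//; rewrite preimage_set0.
- by rewrite -preimage_bigcup -[X in measurable X]setTI;
     exact: measurable_pair_cons.
Qed.

HB.instance Definition _ := isMeasure.Build _ _ _ cons_measure
  cons_measure0 cons_measure_ge0 cons_measure_sigma_additive.

Let cons_measure_sigma_finite : sigma_finite setT cons_measure.
Proof.
have /sigma_finiteP[F [FT ndF Foo]] := sigma_finiteT mu.
have /sigma_finiteP[G [GT ndG Goo]] := sigma_finiteT nu.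
pose uncons (x : k.+1.-tuple T) : T * k.-tuple T :=
  (thead x, [tuple of behead x]).
have muncons : measurable_fun setT uncons.
  apply: measurable_fun_pair => //=; last exact: measurable_behead.
  exact: measurable_tnth.
have unconsE i : @pair_cons k @^-1` (uncons @^-1` (F i `*` G i)) = F i `*` G i.
  rewrite -comp_preimage (_ : _ \o _ = id) //; apply/funext => -[t s] /=.
  by rewrite /uncons /pair_cons theadE; congr pair; exact: val_inj.
exists (fun i => uncons @^-1` (F i `*` G i)).
  apply/esym; rewrite -subTset => x _.
  have [i _ Fi] : (\bigcup_i F i) (thead x) by rewrite -FT.
  have [j _ Gj] : (\bigcup_i G i) [tuple of behead x] by rewrite -GT.
  exists (maxn i j) => //; split => /=.
    by move: Fi; apply/subsetPset/ndF/leq_maxl.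
  by move: Gj; apply/subsetPset/ndG/leq_maxr.
move=> i; have [mFi Fioo] := Foo i; have [mGi Gioo] := Goo i; split.
  by rewrite -[X in measurable X]setTI; apply: muncons => //; exact: measurableX.
rewrite /cons_measure /pushforward unconsE product_measure1E//.
by rewrite lte_mul_pinfty// ge0_fin_numE.
Qed.

HB.instance Definition _ :=
  Measure_isSigmaFinite.Build _ _ _ cons_measure cons_measure_sigma_finite.

End step.

Fixpoint tuple_measure (mu : {sigma_finite_measure set T -> \bar R}) (k : nat) :
    {sigma_finite_measure set (k.-tuple T) -> \bar R} :=
  if k is k'.+1 then cons_measure mu (tuple_measure mu k')
  else \d_([tuple] : 0.-tuple T).

Lemma tuple_measure_box (mu : {sigma_finite_measure set T -> \bar R}) k
    (A : 'I_k -> set T) : (forall i, measurable (A i)) ->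
  tuple_measure mu k [set x | forall i, A i (tnth x i)] = \prod_(i < k) mu (A i).
Proof.
elim: k => [|k IH] in A * => mA.
  rewrite big_ord0 /= /dirac indicE mem_set//; by case.
rewrite big_ord_recl /= -IH// /cons_measure /pushforward.
have mB : measurable [set x : k.-tuple T | forall i, A (lift ord0 i) (tnth x i)].
  rewrite (_ : [set x | _] = \bigcap_(i in [set: 'I_k])
      ((@tnth k T ^~ i) @^-1` A (lift ord0 i))); last first.
    by apply/seteqP; split=> x /= h i => [_|]; exact: h.
  apply: fin_bigcap_measurable => // i _.
  by rewrite -[X in measurable X]setTI; exact: measurable_tnth.
rewrite -product_measure1E//; congr (_ _); apply/seteqP; split=> -[t s] /=.
  by move=> h; split=> [|i]; [exact: (h ord0)|rewrite -(tnthS t); exact: h].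
by move=> [h0 h] i; have [j ->|->//] := unliftP ord0 i; rewrite tnthS; exact: h.
Qed.

End tuple_measure.

Section euclidean_space.
Variables (R : realType) (n : nat).

(* The product sigma-algebra on n-tuples of reals is the Borel one.  There is
   no topology on tuples: it is carried over from the row vectors. *)
Definition Rn : Type := n.-tuple (measurableTypeR R).
HB.instance Definition _ := Measurable.on Rn.

Definition row_of (x : Rn) : 'rV[R]_n := \row_(i < n) tnth x i.

Definition compact_Rn (K : set Rn) := compact (row_of @` K).

Definition open_Rn (U : set Rn) := open (row_of @` U).

Definition edist (x y : Rn) : R :=
  Num.sqrt (\sum_(i < n) (tnth x i - tnth y i) ^+ 2)%R.

Definition lebesgue_Rn : {sigma_finite_measure set Rn -> \bar R} :=
  tuple_measure lebesgue_measure n.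

Definition cube (a : Rn) (l : R) : set Rn :=
  [set x | forall i : 'I_n, tnth x i \in `[tnth a i, tnth a i + l]%R].

Lemma lebesgue_cube (a : Rn) (l : R) : (0 <= l)%R ->
  lebesgue_Rn (cube a l) = (l ^+ n)%:E.
Proof.
move=> l0; rewrite (@tuple_measure_box _ _ _ lebesgue_measure n
  (fun i => `[tnth a i, (tnth a i + l)%R]%classic)) => [|i]; last first.
  exact: measurable_itv.
rewrite (eq_bigr (fun=> l%:E)) => [|i _].
  by rewrite prodEFin prodr_const card_ord.
apply: etrans (lebesgue_measure_itv _) _; rewrite /= lte_fin ltrDl.
case: ltP => [_|l0']; first by rewrite -EFinB addrAC subrr add0r.
by congr (_%:E); apply/eqP; rewrite eq_le l0 l0'.
Qed.

Definition cubes : set (Rn * R) := [set al | (0 < al.2)%R].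

(* Folland's definition; the domain of [mu] is the Borel sigma-algebra. *)
Record radon (mu : {measure set Rn -> \bar R}) : Prop := {
  radon_compact : forall K, compact_Rn K -> mu K < +oo ;
  radon_outer_regular : forall A, measurable A ->
    mu A = ereal_inf [set mu U | U in [set U | open_Rn U /\ A `<=` U]] ;
  radon_inner_regular : forall U, open_Rn U ->
    mu U = ereal_sup [set mu K | K in [set K | compact_Rn K /\ K `<=` U]]
}.

(* Measurability with respect to the completion of [mu].  On such functions
   the library's integral, a supremum over the simple functions below, agrees
   with the one for the completion. *)
Definition ae_measurable d d' (T : measurableType d) (U : measurableType d')
    (mu : {measure set T -> \bar R}) (f : T -> U) : Prop :=
  exists2 g : T -> U, measurable_fun setT g & {ae mu, forall x, f x = g x}.

Definition loc_integrable (f : Rn -> R) : Prop :=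
  ae_measurable lebesgue_Rn f /\
  forall K, compact_Rn K -> \int[lebesgue_Rn]_(x in K) `|f x|%:E < +oo.

(* Extended-real-valued: the integral is -oo as soon as the positive and
   negative parts of the integrand both have infinite integral, so it is finite
   exactly where it converges absolutely. *)
Definition frac_integral (m : nat) (alpha : R) (f : 'I_m -> Rn -> R) (x : Rn) :
    \bar R :=
  \int[tuple_measure lebesgue_Rn m]_y
    ((\prod_(j < m) f j (tnth y j)) /
     (\sum_(j < m) edist x (tnth y j)) `^ ((m * n)%:R - alpha))%R%:E.

Definition volume (a : Rn) (l : R) : R := fine (lebesgue_Rn (cube a l)).

Definition measure_norm (gamma : R) (mu : {measure set Rn -> \bar R}) : \bar R :=
  ereal_sup [set mu (cube al.1 al.2) * ((al.2 `^ gamma)^-1)%:E | al in cubes].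

Definition morrey_norm (m : nat) (P : 'I_m -> R) (p0 : R)
    (f : 'I_m -> Rn -> R) : \bar R :=
  ereal_sup [set (volume al.1 al.2 `^ p0^-1)%:E *
    \prod_(j < m) (((volume al.1 al.2)^-1)%:E *
      \int[lebesgue_Rn]_(y in cube al.1 al.2) (`|f j y| `^ P j)%:E)
        `^ (P j)^-1 | al in cubes].

Definition morrey_space (m : nat) (P : 'I_m -> R) (p0 : R)
    (f : 'I_m -> Rn -> R) : Prop :=
  (forall j, loc_integrable (f j)) /\ morrey_norm P p0 f < +oo.

(* Meaningful for [mu]-measurable [g]. *)
Definition radon_morrey_norm (mu : {measure set Rn -> \bar R}) (q q0 : R)
    (g : Rn -> \bar R) : \bar R :=
  ereal_sup [set (volume al.1 al.2 `^ (q0^-1 - q^-1))%:E *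
    (\int[mu]_(x in cube al.1 al.2) (`|g x| `^ q)) `^ q^-1 | al in cubes].

End euclidean_space.

(* Main.v *)
Require Import Defs.
From mathcomp Require Import all_boot all_order all_algebra.
From mathcomp Require Import all_classical all_reals all_analysis.
From mathcomp Require Import measurable_realfun.
From mathcomp Require Import lra ring.

(* The kernel is split into dyadic shells around a radius delta, so that the
   fractional integral at x is controlled by the products
   B_r = prod_j int_{Q(x,r)} |f_j|.  Bounding B_r by N(x) r^(mn-beta) on the near
   shells, where N is a multilinear fractional maximal function of order beta,
   and by the Morrey norm F times r^(mn-n/p0) on the far ones, the best delta
   gives Hedberg's inequality |I f| <= C N^(1/theta) F^(1-1/theta).  It remains
   to bound int_Q N^p dmu.  Scales above the side of Q are handled by the Morrey
   norm.  Below it, Q(x,r) is contained in a cell of one of 2^n shifted dyadic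
   grids, and normalising the integrals of |f_j|^(p_j) decouples the product into
   single functions with exponents p_j > 1.  For one function and one grid, only
   the strict records of k |-> side_k^b avg_k (b = beta p / p_j) matter; along
   them the plain averages grow geometrically, which gives the strong-type trace
   inequality directly, without interpolation and without the Hardy-Littlewood
   maximal theorem. *)

Set Implicit Arguments.
Unset Strict Implicit.
Unset Printing Implicit Defensive.

Import Order.TTheory GRing.Theory Num.Theory.

Local Open Scope classical_set_scope.
Local Open Scope ring_scope.

(** * Integrals of arbitrary functions *)

Section nonmeasurable_integrands.
Local Open Scope ereal_scope.
Context d (T : measurableType d) (R : realType) (mu : {measure set T -> \bar R}).
Implicit Types (D : set T) (f g : T -> \bar R).
Import HBNNSimple.

(** The functions are arbitrary: the integral is a supremum over simple functions below, and cutting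
    such a function off the null set keeps its integral and puts it below [g]. *)
Lemma ge0_ae_le_integral D f g :
  (forall x, D x -> 0 <= f x) -> (forall x, D x -> 0 <= g x) ->
  {ae mu, forall x, D x -> f x <= g x} ->
  \int[mu]_(x in D) f x <= \int[mu]_(x in D) g x.
Proof.
move=> f0 g0 [N [mN muN fgN]]; rewrite !ge0_integralE//.
apply: ge_ereal_sup => _ [h /= hf <-].
have mNC : measurable (~` N) by exact: measurableC.
have -> : sintegral mu h = sintegral mu (proj_nnsfun h mNC).
  have sE (k : {nnsfun T >-> R}) : sintegral mu k = \int[mu]_x (k x)%:E.
    by rewrite integral_nnsfun// patch_setT.
  rewrite !sE; apply: ge0_ae_eq_integral => //.
  - exact/measurable_EFinP.
  - exact/measurable_EFinP.
  - by move=> x _; rewrite lee_fin.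
  - by move=> x _; rewrite lee_fin.
  exists N; split => // x /=; apply: contra_notP => Nx _.
  by rewrite mindicE mem_set// mulr1.
apply: ereal_sup_ubound; exists (proj_nnsfun h mNC) => //= x.
rewrite mindicE; have [Nx|Nx] := pselect (N x).
  rewrite memNset ?mulr0//.
  by rewrite patchE; case: ifPn => // /[!inE] /g0.
rewrite mem_set// mulr1; apply: (le_trans (hf x)); rewrite !patchE.
case: ifPn => // /[!inE] Dx; apply: contrapT => fg; apply: Nx; apply: fgN => /=.
by move=> /(_ Dx).
Qed.

Lemma ge0_ae_eq_integral_any D f g :
  (forall x, D x -> 0 <= f x) -> (forall x, D x -> 0 <= g x) ->
  {ae mu, forall x, D x -> f x = g x} ->
  \int[mu]_(x in D) f x = \int[mu]_(x in D) g x.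
Proof.
move=> f0 g0 fg; apply/eqP; rewrite eq_le; apply/andP; split.
  by apply: ge0_ae_le_integral => //; apply: filterS fg => x h /h ->.
by apply: ge0_ae_le_integral => //; apply: filterS fg => x h /h ->.
Qed.

Lemma ae_eq_integral_any f g : {ae mu, forall x, f x = g x} ->
  \int[mu]_x f x = \int[mu]_x g x.
Proof.
move=> fg; rewrite integralE [RHS]integralE; congr (_ - _);
  apply: ge0_ae_eq_integral_any => //; apply: filterS fg => x fgx _.
  by rewrite !funeposE fgx.
by rewrite !funenegE fgx.
Qed.

Lemma ge0_le_integral_any D f g : (forall x, D x -> 0 <= f x) ->
  (forall x, D x -> f x <= g x) ->
  \int[mu]_(x in D) f x <= \int[mu]_(x in D) g x.
Proof.
move=> f0 fg; apply: ge0_ae_le_integral => //.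
  by move=> x Dx; apply: le_trans (f0 _ Dx) (fg _ Dx).
exact: aeW.
Qed.

End nonmeasurable_integrands.

(** * Geometric series and power means *)

Lemma nneseries_geometric_le (R : realType) (a z : R) :
  0 <= a -> 0 < z -> z < 1 ->
  (\sum_(0 <= i <oo) (a * z ^+ i)%:E <= (a / (1 - z))%:E)%E.
Proof.
move=> a0 z0 z1; apply: lime_le.
  by apply: is_cvg_nneseries => i _ _; rewrite lee_fin mulr_ge0// exprn_ge0// ltW.
apply: nearW => N; rewrite sumEFin lee_fin.
rewrite ler_pdivlMr ?subr_gt0//.
have -> : \sum_(0 <= i < N) a * z ^+ i = a * \sum_(0 <= i < N) z ^+ i.
  by rewrite mulr_sumr.
rewrite -mulrA ler_piMr// mulrC -[in leLHS]opprB mulNr.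
rewrite big_mkord -subrX1 opprB lerBlDr lerDl exprn_ge0// ltW//.
Qed.

(** Jensen's inequality for the power [s], by Young's inequality against a constant. The normalising
    volume [v] is an upper bound of [mu D], which suits grid cells lying in cubes of known
    volume. *)
Lemma average_powR_le d (T : measurableType d) (R : realType)
    (mu : {measure set T -> \bar R}) (D : set T) (v s : R) (f : T -> R) :
  measurable D -> measurable_fun setT f -> (forall x, 0 <= f x) ->
  0 < v -> (mu D <= v%:E)%E -> 1 < s ->
  (((v^-1)%:E * \int[mu]_(x in D) (f x)%:E) <=
   ((v^-1)%:E * \int[mu]_(x in D) (f x `^ s)%:E) `^ s^-1)%E.
Proof.
move=> mD mf f0 v0 muD s1; have s0 : 0 < s by exact: lt_trans s1.
set If := (\int[mu]_(x in D) (f x)%:E)%E.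
set Is := (\int[mu]_(x in D) (f x `^ s)%:E)%E.
have If0 : (0 <= If)%E by apply: integral_ge0 => x _; rewrite lee_fin.
have Is0 : (0 <= Is)%E by apply: integral_ge0 => x _; rewrite lee_fin powR_ge0.
have [Isoo|Isoo] := eqVneq Is +oo%E.
  rewrite Isoo gt0_muley ?lte_fin ?invr_gt0// poweRyr ?leey//.
  by rewrite gt_eqF// invr_gt0.
have Isfin : Is \is a fin_num by rewrite ge0_fin_numE// ltey.
have mfE : measurable_fun D (fun x => (f x)%:E).
  by apply/measurable_EFinP; exact: measurable_funTS.
have mfs : measurable_fun D (fun x => (f x `^ s)%:E).
  apply/measurable_EFinP; apply: measurable_funTS.
  exact: measurableT_comp (measurable_powR s) mf.
pose q := s / (s - 1).
have s10 : 0 < s - 1 by rewrite subr_gt0.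
have q0 : 0 < q by rewrite divr_gt0.
have sq : s^-1 + q^-1 = 1.
  by rewrite /q invf_div mulrBl mul1r divff ?gt_eqF// addrC subrK.
(* Young's inequality for [f] against the constant [c ^ (s - 1)] *)
have young c : 0 < c ->
    ((c `^ (s - 1))%:E * If <= (s^-1)%:E * Is + (c `^ s / q * v)%:E)%E.
  move=> c0.
  have csq : (c `^ (s - 1)) `^ q = c `^ s.
    by rewrite -powRrM /q mulrCA divff ?mulr1// gt_eqF.
  rewrite -ge0_integralZl_EFin ?powR_ge0//; last first.
    by move=> x _; rewrite lee_fin.
  apply: (@le_trans _ _ (\int[mu]_(x in D)
      ((s^-1)%:E * (f x `^ s)%:E + (c `^ s / q)%:E))%E).
    apply: ge0_le_integral_any => x _.
      by rewrite -EFinM lee_fin mulr_ge0// powR_ge0.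
    rewrite -!EFinM -EFinD lee_fin mulrC (mulrC s^-1) -csq.
    by apply: conjugate_powR => //; exact: powR_ge0.
  rewrite ge0_integralD//; last 3 first.
  - by move=> x _; rewrite -EFinM lee_fin mulr_ge0 ?invr_ge0 ?powR_ge0 ?ltW.
  - exact: measurable_funeM.
  - by move=> x _; rewrite lee_fin divr_ge0 ?powR_ge0 ?ltW.
  rewrite ge0_integralZl_EFin ?invr_ge0 ?(ltW s0)//; last first.
    by move=> x _; rewrite lee_fin powR_ge0.
  rewrite leeD2l// integral_cst// (EFinM _ v) lee_wpmul2l//.
  by rewrite lee_fin divr_ge0 ?powR_ge0 ?ltW.
(* The constant 1 in Young's inequality already bounds [If] by a finite quantity; the best constant,
   the average itself, can only be used afterwards. *)
have Iffin : If \is a fin_num.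
  rewrite ge0_fin_numE//; have := young 1 ltr01.
  rewrite !powR1 mul1e => /le_lt_trans; apply.
  by rewrite -(fineK Isfin) -EFinM -EFinD ltry.
move: young; rewrite -(fineK Iffin) -(fineK Isfin).
have : 0 <= fine If by exact: fine_ge0.
move: (fine If) (fine Is) (fine_ge0 Is0) => I J J0 I0 young.
rewrite -!EFinM poweR_EFin lee_fin.
have [->|cn0] := eqVneq (v^-1 * I) 0; first exact: powR_ge0.
have c0 : 0 < v^-1 * I by rewrite lt_neqAle eq_sym cn0 mulr_ge0// invr_ge0 ltW.
have /= := young _ c0; rewrite -!EFinM -EFinD lee_fin.
set c := v^-1 * I => h.
have cI : I = v * c by rewrite /c mulrA divff ?mul1r// gt_eqF.
suff cJ : c `^ s <= v^-1 * J.
  have -> : c = (c `^ s) `^ s^-1 by rewrite -powRrM divff ?powRr1 ?gt_eqF ?ltW.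
  apply: ge0_ler_powR => //; rewrite ?invr_ge0 ?nnegrE ?powR_ge0 ?(ltW s0)//.
  by rewrite mulr_ge0 ?invr_ge0 ?(ltW v0).
(* With [c] the average, the left side of Young's inequality is v c^s, which absorbs the term v c^s
   / q because 1 - 1/q = 1/s. *)
have cs : c `^ (s - 1) * I = v * c `^ s.
  by rewrite cI mulrCA -(mulr_powRB1 (ltW c0) s0) (mulrC c).
rewrite cs in h; rewrite mulrC ler_pdivlMr//.
rewrite -(ler_pM2l (x := s^-1)) ?invr_gt0//.
have -> : s^-1 * (c `^ s * v) = v * c `^ s - c `^ s / q * v.
  by have -> : s^-1 = 1 - q^-1 by [rewrite -sq addrK|]; ring.
by rewrite lerBlDr.
Qed.

(** * Integrals over tuples *)

Section tuple_integrals.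
Context d (T : measurableType d) (R : realType).
Variable mu : {sigma_finite_measure set T -> \bar R}.
Local Open Scope ereal_scope.

Lemma measurable_prod_tnth k (g : 'I_k -> T -> \bar R) :
  (forall i, measurable_fun setT (g i)) ->
  measurable_fun setT (fun y : k.-tuple T => \prod_(i < k) g i (tnth y i)).
Proof.
move=> mg; elim: (index_enum _) => [|i s ih].
  by under eq_fun do rewrite big_nil; exact: measurable_cst.
under eq_fun do rewrite big_cons; apply: emeasurable_funM => //.
by apply: measurableT_comp (mg i) _; exact: measurable_tnth.
Qed.

Lemma integral_tuple_prod k (g : 'I_k -> T -> \bar R) :
  (forall i, measurable_fun setT (g i)) -> (forall i x, 0 <= g i x) ->
  \int[tuple_measure mu k]_y \prod_(i < k) g i (tnth y i) =
  \prod_(i < k) \int[mu]_x g i x.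
Proof.
elim: k => [|k IH] in g * => mg g0.
  rewrite big_ord0; under eq_integral do rewrite big_ord0.
  by rewrite integral_dirac//= diracT mul1e.
rewrite big_ord_recl -IH//.
rewrite /= (ge0_integral_pushforward (@measurable_pair_cons _ T k))//; last 2 first.
- exact: measurable_prod_tnth.
- by move=> y _; exact: prode_ge0.
have pcE (x : T) (y : k.-tuple T) :
    \prod_(i < k.+1) g i (tnth (pair_cons (x, y)) i) =
    g ord0 x * \prod_(i < k) g (lift ord0 i) (tnth y i).
  rewrite big_ord_recl; congr (_ * _).
  by apply: eq_bigr => i _; rewrite tnthS.
rewrite preimage_setT fubini_tonelli1; last 2 first.
- apply: measurableT_comp (measurable_prod_tnth mg) _.
  exact: measurable_pair_cons.
- by move=> y; exact: prode_ge0.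
rewrite /fubini_F /=.
under eq_integral => x _ do under eq_integral => y _ do rewrite pcE.
have mG : measurable_fun setT
    (fun y : k.-tuple T => \prod_(i < k) g (lift ord0 i) (tnth y i)).
  exact: (measurable_prod_tnth (fun i => mg (lift ord0 i))).
under eq_integral => x _.
  rewrite ge0_integralZl//; last by move=> y _; exact: prode_ge0.
  over.
rewrite /= ge0_integralZr//.
by apply: integral_ge0 => y _; exact: prode_ge0.
Qed.

(** The exceptional set lies in a box with one null side and full other sides; its measure is a
    product with a factor 0, and 0 times infinity is 0. *)
Lemma ae_tnth k (i : 'I_k) (P : T -> Prop) :
  {ae mu, forall x, P x} -> {ae tuple_measure mu k, forall y, P (tnth y i)}.
Proof.
move=> [N [mN muN PN]]; exists ((@tnth k T ^~ i) @^-1` N); split.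
- by rewrite -[X in measurable X]setTI; exact: measurable_tnth.
- pose A j := if j == i then N else setT.
  have mA j : measurable (A j) by rewrite /A; case: ifP.
  have -> : (@tnth k T ^~ i) @^-1` N = [set x | forall j, A j (tnth x j)].
    apply/seteqP; split=> x /= => [Nx j|/(_ i)]; last by rewrite /A eqxx.
    by rewrite /A; case: eqP => // ->.
  rewrite tuple_measure_box// (bigD1 i)//=.
  have -> : mu (A i) = 0 by rewrite /A eqxx; exact: muN.
  by rewrite mul0e.
- by move=> y /= nP; exact: PN.
Qed.

End tuple_integrals.

(** * A trace inequality for nested partitions *)

(* At the strict records of [lam * tau] the sequence [tau] grows at least by the
   factor [rho^-1], so the sum is dominated by its last term. *)
Lemma record_sum_le (R : realType) (tau lam : nat -> R) (sel : pred nat)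
    (rho s B : R) (N : nat) :
  0 < rho -> rho < 1 -> 0 < s -> (forall j, 0 <= tau j) ->
  (forall j, 0 < lam j) -> (forall i j, (i < j)%N -> lam j <= rho * lam i) ->
  (forall i j, (i < j)%N -> sel j -> lam i * tau i < lam j * tau j) ->
  0 <= B -> (forall j, (j < N)%N -> sel j -> tau j <= B) ->
  \sum_(0 <= j < N | sel j) tau j `^ s <= B `^ s / (1 - rho `^ s).
Proof.
move=> rho0 rho1 s0 tau0 lam0 lam_rho recs.
have rs1 : rho `^ s < 1.
  by have := @gt0_ltr_powR R s s0 rho 1; rewrite powR1 !nnegrE ler01 ltW//; exact.
have rs0 : 0 < 1 - rho `^ s by rewrite subr_gt0.
elim: N B => [|N IH] B B0 tauB.
  by rewrite big_mkcond big_geq// divr_ge0 ?powR_ge0 ?(ltW rs0).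
rewrite big_mkcond big_nat_recr//= -big_mkcond /=.
have [selN|selN] := boolP (sel N); last first.
  by rewrite addr0 IH// => j jN; apply: tauB; rewrite ltnS ltnW.
have tN : tau N `^ s <= B `^ s.
  by apply: ge0_ler_powR; rewrite ?nnegrE ?(ltW s0) ?tauB.
apply: (@le_trans _ _ (tau N `^ s / (1 - rho `^ s))); last first.
  by rewrite ler_pM2r// invr_gt0.
(* As [N] is a record, each [j < N] has [lam j * tau j < lam N * tau N <= rho * lam j * tau N], so
   the induction hypothesis applies with the smaller bound [rho * tau N]. *)
have IHN : \sum_(0 <= j < N | sel j) tau j `^ s <=
    (rho * tau N) `^ s / (1 - rho `^ s).
  apply: IH => [|j jN selj]; first by rewrite mulr_ge0// ltW.
  have := recs _ _ jN selN; have := lam_rho _ _ jN; have := lam0 j.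
  by have := tau0 N; nra.
apply: (le_trans (lerD IHN (lexx _))).
rewrite powRM ?tau0 ?(ltW rho0)//.
by rewrite le_eqVlt; apply/orP; left; apply/eqP; field; rewrite gt_eqF.
Qed.

(** A function constant on cells has unions of cells as preimages, and these unions are
    countable. *)
Lemma measurable_fun_cells d (T : measurableType d) d' (U : measurableType d')
    (idx : T -> nat) (F : T -> U) :
  (forall k, measurable (idx @^-1` [set k])) ->
  (forall x y, idx x = idx y -> F x = F y) -> measurable_fun setT F.
Proof.
move=> midx Fidx _ Y mY; rewrite setTI.
rewrite (_ : _ @^-1` _ = \bigcup_(k in idx @` (F @^-1` Y)) (idx @^-1` [set k])).
  exact: bigcup_measurable.
apply/seteqP; split=> x /=; first by move=> FY; exists (idx x) => //; exists x.
by move=> [_ [y FY <-]] /= /Fidx ->.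
Qed.

(** The first factor 2 pays for discarding the part of a cell where [G] is at most half the average;
    the rest is the constant of [record_sum_le] for the exponent [s - 1] and averages below
    [2 * G x]. *)
Definition trace_const (R : realType) (rho s : R) : R :=
  2 * (2 `^ (s - 1) / (1 - rho `^ (s - 1))).

(* [H] is the sum of the powers of the strict records of [j |-> lam j * avg j].
   On a cell where [j] is a record, [v * avg] is at most twice the integral of [G]
   over the part of the cell where [avg < 2 * G]; hence the record powers are
   paid for pointwise by [G], through [record_sum_le]. *)
Lemma nested_cells_trace d (T : measurableType d) (R : realType)
    (mu nu : {measure set T -> \bar R}) (idx : nat -> T -> nat)
    (v lam : nat -> R) (rho s M : R) (G : T -> R) :
  (forall j k, measurable (idx j @^-1` [set k])) ->
  (forall j x y, idx j.+1 x = idx j.+1 y -> idx j x = idx j y) ->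
  (forall j, 0 < v j) -> (forall j, 0 < lam j) ->
  0 < rho -> rho < 1 -> (forall j, lam j.+1 <= rho * lam j) ->
  1 < s -> 0 <= M ->
  (forall j k, nu (idx j @^-1` [set k]) <= (v j)%:E)%E ->
  (forall j k, mu (idx j @^-1` [set k]) <= (M * (v j * lam j `^ (- s)))%:E)%E ->
  measurable_fun setT G -> (forall x, 0 <= G x) ->
  (\int[nu]_x (G x `^ s)%:E < +oo)%E ->
  exists H : T -> \bar R, [/\ measurable_fun setT H, (forall x, 0 <= H x)%E,
    (forall j x, ((lam j / v j)%:E *
       \int[nu]_(y in idx j @^-1` [set idx j x]) (G y)%:E) `^ s <= H x)%E &
    (\int[mu]_x H x <= (trace_const rho s * M)%:E * \int[nu]_x (G x `^ s)%:E)%E].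
Proof.
move=> midx nest v0 lam0 rho0 rho1 lam_rho s1 M0 nuv muv mG G0 Gs.
have s0 : 0 < s by exact: lt_trans s1.
have s10 : 0 < s - 1 by rewrite subr_gt0.
pose cell j k := idx j @^-1` [set k].
pose tau j k := (v j)^-1 * fine (\int[nu]_(y in cell j k) (G y)%:E)%E.
pose a j x := lam j * tau j (idx j x).
have intG_ge0 j k : (0 <= \int[nu]_(y in cell j k) (G y)%:E)%E.
  by apply: integral_ge0 => y _; rewrite lee_fin.
(* Finiteness comes from Jensen's inequality and the finite integral of the power of [G]. *)
have intG_fin j k : (\int[nu]_(y in cell j k) (G y)%:E)%E \is a fin_num.
  rewrite ge0_fin_numE//.
  have := average_powR_le (midx j k) mG G0 (v0 j) (nuv j k) s1.
  move=> /le_lt_trans h.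
  have {}h : (((v j)^-1)%:E * \int[nu]_(y in cell j k) (G y)%:E < +oo)%E.
    apply: h; apply: poweR_lty; rewrite lte_mul_pinfty ?lee_fin ?invr_ge0 ?ltW//.
    apply: le_lt_trans Gs; apply: ge0_subset_integral => //.
    - by apply/measurable_EFinP; exact: measurableT_comp (measurable_powR s) mG.
    - by move=> x _; rewrite lee_fin powR_ge0.
  rewrite ltey; apply: contraTneq h => ->.
  by rewrite gt0_muley ?lte_fin ?invr_gt0// ltxx.
have tau0 j k : 0 <= tau j k by rewrite mulr_ge0 ?invr_ge0 ?fine_ge0 ?(ltW (v0 j)).
have nest_le j i x y : (i <= j)%N -> idx j x = idx j y -> idx i x = idx i y.
  elim: j => [|j IH]; first by rewrite leqn0 => /eqP ->.
  by rewrite leq_eqVlt => /predU1P[->//|ij] /nest; exact: IH.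
have a_cell j i x y : (i <= j)%N -> idx j x = idx j y -> a i x = a i y.
  by move=> ij xy; rewrite /a (nest_le _ _ _ _ ij xy).
(* A strict record exceeds all earlier values; [j = 0] is one vacuously. *)
pose rec j x := [forall i : 'I_j, a i x < a j x].
have rec_cell j x y : idx j x = idx j y -> rec j x = rec j y.
  move=> xy; apply: eq_forallb => i.
  by rewrite (a_cell _ _ _ _ (ltnW (ltn_ord i)) xy) (a_cell _ _ _ _ (leqnn j) xy).
pose h j x := if rec j x then a j x `^ s else 0.
have h_cell j x y : idx j x = idx j y -> h j x = h j y.
  by move=> xy; rewrite /h (rec_cell _ _ _ xy) (a_cell _ _ _ _ (leqnn j) xy).
have h0 j x : 0 <= h j x by rewrite /h; case: ifP; rewrite ?powR_ge0.
pose c j x := if rec j x then tau j (idx j x) `^ (s - 1) else 0.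
have c_cell j x y : idx j x = idx j y -> c j x = c j y.
  by move=> xy; rewrite /c (rec_cell _ _ _ xy) xy.
have c0 j x : 0 <= c j x by rewrite /c; case: ifP; rewrite ?powR_ge0.
(* The part of [G] above half of the cell average carries at least half of the integral of [G] over
   the cell. *)
pose g j x := if tau j (idx j x) < 2 * G x then G x else 0.
have g0 j x : 0 <= g j x by rewrite /g; case: ifP.
have mh j : measurable_fun setT (h j) by exact: measurable_fun_cells (midx j) (h_cell j).
have mc j : measurable_fun setT (c j) by exact: measurable_fun_cells (midx j) (c_cell j).
have mg j : measurable_fun setT (g j).
  apply: measurable_fun_ifT => //; apply: measurable_fun_ltr.
    by apply: (measurable_fun_cells (midx j)) => x y /= ->.
  by apply: measurable_funM => //; exact: measurable_cst.
pose phi j x := c j x * g j x.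
have phi0 j x : 0 <= phi j x by rewrite mulr_ge0.
have mphi j : measurable_fun setT (phi j) by exact: measurable_funM.
have bigcup_cell j : \bigcup_k cell j k = setT.
  by apply/seteqP; split=> // x _; exists (idx j x).
have triv_cell j : trivIset setT (cell j).
  apply/trivIsetP => i k _ _ ik; apply/seteqP; split => // x /= [xi xk].
  by move/eqP: ik; apply; rewrite -xi -xk.
have cell_le j k : (\int[mu]_(x in cell j k) (h j x)%:E <=
    (2 * M)%:E * \int[nu]_(x in cell j k) (phi j x)%:E)%E.
  have [[x0 x0k]|cell0] := pselect (cell j k !=set0); last first.
    have -> : cell j k = set0 by apply: contrapT => /eqP/set0P.
    by rewrite !integral_set0 mule0.
  have inx x : x \in cell j k -> idx j x = idx j x0 by rewrite inE x0k.
  under eq_integral => x /inx xx0 do rewrite (h_cell _ _ _ xx0).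
  under [in leRHS]eq_integral => x /inx xx0 do
    rewrite /phi (c_cell _ _ _ xx0) EFinM.
  rewrite integral_cst; last exact: midx.
  rewrite ge0_integralZl_EFin//; last 3 first.
  - exact: midx.
  - by move=> x _; rewrite lee_fin.
  - by apply/measurable_EFinP; exact: measurable_funTS.
  rewrite /h /c; case: ifP => _; last by rewrite !mul0e mule0.
  apply: (le_trans (lee_wpmul2l _ (muv j k))); first by rewrite lee_fin powR_ge0.
  rewrite /a -!EFinM; set t := tau j (idx j x0).
  have t0 : 0 <= t by exact: tau0.
  (* The weight in the bound on [mu] cancels the power of [lam j], and the factor [v j * t] is set
     apart as the integral of [G] over the cell. *)
  have -> : (lam j * t) `^ s * (M * (v j * lam j `^ (- s))) =
      2 * M * (t `^ (s - 1) * (v j * t / 2)).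
    rewrite powRM ?(ltW (lam0 j))// powRN -(mulr_powRB1 t0 s0).
    by field; rewrite powR_eq0 negb_and gt_eqF.
  rewrite EFinM lee_wpmul2l ?lee_fin ?mulr_ge0// EFinM lee_wpmul2l ?lee_fin ?powR_ge0//.
  have vt : ((v j * t)%:E = \int[nu]_(x in cell j k) (G x)%:E)%E.
    by rewrite /t /tau x0k mulrA divff ?mul1r ?fineK// gt_eqF.
  have : ((v j * t)%:E <= \int[nu]_(x in cell j k) (g j x)%:E + (v j * t / 2)%:E)%E.
    rewrite vt; apply: (@le_trans _ _ (\int[nu]_(x in cell j k) ((g j x)%:E + (t / 2)%:E))%E).
      apply: ge0_le_integral_any => [x _|x xk]; first by rewrite lee_fin.
      rewrite -EFinD lee_fin /g; rewrite /t x0k -xk; case: ltP => hG.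
        by rewrite lerDl divr_ge0.
      by rewrite add0r ler_pdivlMr// mulrC.
    rewrite ge0_integralD//; last 4 first.
    - exact: midx.
    - by move=> x _; rewrite lee_fin.
    - by apply/measurable_EFinP; exact: measurable_funTS.
    - by move=> x _; rewrite lee_fin divr_ge0.
    rewrite leeD2l// integral_cst; last exact: midx.
    apply: (le_trans (lee_wpmul2l _ (nuv j k))); first by rewrite lee_fin divr_ge0.
    by rewrite -EFinM lee_fin mulrC mulrA.
  rewrite -leeBlDr// -EFinB => hv; apply: le_trans hv.
  by rewrite lee_fin; lra.
have h_le j : (\int[mu]_x (h j x)%:E <= (2 * M)%:E * \int[nu]_x (phi j x)%:E)%E.
  rewrite -(bigcup_cell j) ge0_integral_bigcup//; last 3 first.
  - exact: midx.
  - by rewrite bigcup_cell; exact/measurable_EFinP.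
  - by move=> x _; rewrite lee_fin.
  rewrite ge0_integral_bigcup//; last 3 first.
  - exact: midx.
  - by rewrite bigcup_cell; exact/measurable_EFinP.
  - by move=> x _; rewrite lee_fin.
  rewrite -nneseriesZl; last first.
    by move=> k _; apply: integral_ge0 => x _; rewrite lee_fin.
  apply: lee_nneseries => k *; last exact: cell_le.
  by apply: integral_ge0 => x _; rewrite lee_fin.
exists (fun x => \sum_(0 <= j <oo) (h j x)%:E)%E; split.
- by apply: ge0_emeasurable_sum => j *; [rewrite lee_fin|exact/measurable_EFinP].
- by move=> x; apply: nneseries_ge0 => j _ _; rewrite lee_fin.
- move=> j x.
  have -> : ((lam j / v j)%:E * \int[nu]_(y in cell j (idx j x)) (G y)%:E)%E = (a j x)%:E.
    by rewrite -(fineK (intG_fin _ _)) -EFinM /a /tau mulrA.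
  (* Passing from an index that is not a record to an earlier one with at least the same value ends
     at a record, so the records alone dominate all scales. *)
  have [i [reci aji]] : exists i, rec i x /\ a j x <= a i x.
    elim/ltn_ind: j => j IH.
    have [recj|] := boolP (rec j x); first by exists j.
    rewrite negb_forall => /existsP[i]; rewrite -leNgt => aji.
    have [k [reck aik]] := IH _ (ltn_ord i).
    by exists k; split => //; exact: le_trans aji aik.
  rewrite poweR_EFin; apply: (@le_trans _ _ (h i x)%:E).
    rewrite /h reci lee_fin; apply: ge0_ler_powR => //; first exact: ltW.
    - by rewrite nnegrE mulr_ge0// ltW.
    - by rewrite nnegrE mulr_ge0// ltW.
  apply: (@le_trans _ _ (\sum_(0 <= k < i.+1) (h k x)%:E)%E).
    by rewrite big_nat_recr//= leeDr// sume_ge0// => k _; rewrite lee_fin.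
  by apply: nneseries_lim_ge => *; rewrite lee_fin.
rewrite integral_nneseries//; last 2 first.
- by move=> j; exact/measurable_EFinP.
- by move=> j x _; rewrite lee_fin.
apply: (@le_trans _ _ (\sum_(0 <= j <oo) ((2 * M)%:E * \int[nu]_x (phi j x)%:E))%E).
  apply: lee_nneseries => j *; last exact: h_le.
  by apply: integral_ge0 => x _; rewrite lee_fin.
rewrite nneseriesZl; last first.
  by move=> k _; apply: integral_ge0 => x _; rewrite lee_fin.
rewrite -integral_nneseries//; last 2 first.
- by move=> j; exact/measurable_EFinP.
- by move=> j x _; rewrite lee_fin.
have -> : trace_const rho s * M = 2 * M * (2 `^ (s - 1) / (1 - rho `^ (s - 1))).
  by rewrite /trace_const mulrAC.
rewrite [in leRHS]EFinM -muleA lee_wpmul2l ?lee_fin ?mulr_ge0//.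
have rs1 : rho `^ (s - 1) < 1.
  have := @gt0_ltr_powR R (s - 1) s10 rho 1.
  by rewrite powR1 !nnegrE ler01 ltW//; exact.
rewrite -ge0_integralZl_EFin//; last 3 first.
- by move=> x _; rewrite lee_fin powR_ge0.
- by apply/measurable_EFinP; exact: measurableT_comp (measurable_powR s) mG.
- by rewrite divr_ge0 ?powR_ge0// subr_ge0 ltW.
apply: ge0_le_integral_any => x _.
  by apply: nneseries_ge0 => j _ _; rewrite lee_fin.
apply: lime_le; first by apply: is_cvg_nneseries => *; rewrite lee_fin.
apply: nearW => N; rewrite sumEFin -EFinM lee_fin.
(* At a fixed point only the records with average below [2 * G x] contribute, and along them the
   averages grow geometrically. *)
pose sel j := rec j x && (tau j (idx j x) < 2 * G x).
have -> : \sum_(0 <= j < N) phi j x =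
    G x * \sum_(0 <= j < N | sel j) tau j (idx j x) `^ (s - 1).
  rewrite [in RHS]big_mkcond mulr_sumr; apply: eq_bigr => j _.
  rewrite /phi /c /g /sel; case: (rec j x) => /=; last by rewrite mul0r mulr0.
  by case: ifP => _; rewrite ?mulr0// mulrC.
have recsum : \sum_(0 <= j < N | sel j) tau j (idx j x) `^ (s - 1) <=
    (2 * G x) `^ (s - 1) / (1 - rho `^ (s - 1)).
  apply: (@record_sum_le R (fun j => tau j (idx j x)) lam) => //.
  - move=> i; elim=> // j IH; rewrite ltnS leq_eqVlt => /predU1P[->//|ij].
    apply: (le_trans (lam_rho j)); have := IH ij.
    have := lam0 i; have := lam0 j; nra.
  - by move=> i j ij /andP[/forallP/(_ (Ordinal ij))].
  - by rewrite mulr_ge0.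
  - by move=> j _ /andP[_ /ltW].
apply: (le_trans (ler_wpM2l (G0 x) recsum)).
rewrite powRM// -(mulr_powRB1 (G0 x) s0) le_eqVlt; apply/orP; left; apply/eqP.
by ring.
Qed.

(** * Shifted dyadic grids *)

(** The least [i] satisfying the first inequality works: the second one is its minimality, or
    [r <= l] when [i = 0]. *)
Lemma dyadic_shell (R : realType) (l r : R) : 0 < r -> r <= l ->
  exists i : nat, l / 2 ^+ i.+1 < r <= l / 2 ^+ i.
Proof.
move=> r0 rl; have l0 : 0 < l by exact: lt_le_trans rl.
have exi : exists i : nat, l / 2 ^+ i.+1 < r.
  exists (Num.truncn (l / r)); rewrite ltr_pdivrMr ?exprn_gt0// mulrC.
  rewrite -ltr_pdivrMr//; apply: (lt_le_trans (truncnS_gt _)).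
  by rewrite -natrX ler_nat ltnW// ltn_expl.
case: (ex_minnP exi) => -[|i] hi mini.
  by exists 0%N; rewrite hi expr0 divr1.
exists i.+1; rewrite hi /= leNgt; apply/negP => /mini; rewrite ltnn//.
Qed.

Section shifted_grids.
Variables (R : realType) (L : R).
Hypothesis L0 : 0 < L.

(** The one-third trick, in units of the side: [false] stands for the ordinary dyadic grid, [true]
    for the one moved by a third of the side. *)
Definition grid_shift (t : bool) (j : nat) : R := (-1) ^+ j * t%:R / 3.

(* Alternating the sign of the shift makes the grids of successive scales
   nested, since the two shifts then differ by [t] up to the factor 2. *)
Definition grid_index (t : bool) (j : nat) (x : R) : int :=
  Num.floor (x / (L / 2 ^+ j) - grid_shift t j).

Let side_gt0 j : 0 < L / 2 ^+ j.
Proof. by rewrite divr_gt0 ?exprn_gt0. Qed.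

Lemma grid_indexP t j x k : grid_index t j x = k <->
  L / 2 ^+ j * (k%:~R + grid_shift t j) <= x <
  L / 2 ^+ j * (k%:~R + grid_shift t j) + L / 2 ^+ j.
Proof.
have s0 := side_gt0 j; set s := L / 2 ^+ j in s0 *.
rewrite /grid_index -/s; set c := grid_shift t j.
have -> : (s * (k%:~R + c) <= x) = (k%:~R <= x / s - c).
  by rewrite lerBrDr ler_pdivlMr// mulrC.
have -> : (x < s * (k%:~R + c) + s) = (x / s - c < (k + 1)%:~R).
  rewrite ltrBlDr ltr_pdivrMr// intrD; congr (_ < _); by ring.
by rewrite -floor_eq; split => /eqP.
Qed.

Lemma grid_index_nested t j x y :
  grid_index t j.+1 x = grid_index t j.+1 y -> grid_index t j x = grid_index t j y.
Proof.
pose e : int := (-1) ^+ j * (t : nat)%:Z.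
have half z : z / (L / 2 ^+ j) - grid_shift t j =
    ((z / (L / 2 ^+ j.+1) - grid_shift t j.+1) - e%:~R) / 2.
  have -> : e%:~R = (-1) ^+ j * t%:R :> R by rewrite /e rmorphM rmorphXn /= rmorphN1.
  rewrite /grid_shift !exprS; field.
  by rewrite expf_neq0//= gt_eqF.
rewrite /grid_index !half.
move: (_ - grid_shift t j.+1) (_ - grid_shift t j.+1) => u w uw.
(* The inequality z <= (a - e)/2 means 2z + e <= a, a comparison with an integer, which depends on
   [a] only through its floor. *)
suff H (a b : R) : Num.floor a = Num.floor b ->
    Num.floor ((a - e%:~R) / 2) <= Num.floor ((b - e%:~R) / 2).
  by apply/eqP; rewrite eq_le !H.
move=> ab; set z := Num.floor ((a - e%:~R) / 2).
have : z%:~R <= (a - e%:~R) / 2 by exact: floor_le.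
rewrite floor_ge_int !ler_pdivlMr// !lerBrDr.
have -> : z%:~R * 2 + e%:~R = (z * 2 + e)%:~R :> R by rewrite intrD intrM.
by rewrite -!floor_ge_int ab.
Qed.

(* The two grids have their endpoints at distance at least a third of the
   side from one another, so a short interval misses one of them. *)
Lemma grid_index_local j x r : 0 <= r -> 6 * r < L / 2 ^+ j ->
  exists t, forall y, `|y - x| <= r -> grid_index t j y = grid_index t j x.
Proof.
move=> r0 r6; have s0 := side_gt0 j; rewrite /grid_index.
set s := L / 2 ^+ j in r6 s0 *.
pose u := x / s; pose d := r / s.
have d0 : 0 <= d by rewrite divr_ge0// ltW.
have d6 : 6 * d < 1 by rewrite /d mulrA ltr_pdivrMr// mul1r.
have near y : `|y - x| <= r -> u - d <= y / s <= u + d.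
  rewrite ler_norml lerBlDl lerBrDl => /andP[h1 h2].
  by rewrite /u /d -mulrBl -mulrDl !ler_pM2r ?invr_gt0//; lra.
have [same|diff] := eqVneq (Num.floor (u - d)) (Num.floor (u + d)).
  have sameE w : u - d <= w <= u + d -> Num.floor w = Num.floor (u - d).
    move=> /andP[w1 w2]; apply/eqP; rewrite eq_le {1}same.
    by rewrite !le_floor.
  exists false => y /near yx; rewrite /grid_shift mulr0 mul0r !subr0 -/u.
  by rewrite !sameE//; lra.
(* Otherwise the endpoint [z] of the unshifted grid is within [2 * d < 1/3] of every point of the
   interval; a shift by a third, in either direction, puts the whole interval in one cell. *)
pose z := Num.floor (u + d).
have zu : z%:~R <= u + d by exact: floor_le.
have uz : u - d < z%:~R.
  rewrite -floor_lt_int lt_neqAle diff /=; apply: le_floor; lra.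
have nz w : u - d <= w <= u + d -> z%:~R - 1/3 < w < z%:~R + 1/3 by lra.
have hs : grid_shift true j = 1/3 \/ grid_shift true j = - (1/3).
  rewrite /grid_shift mulr1 -signr_odd; case: odd; [right|left] => /=.
    by rewrite expr1 mulN1r mul1r.
  by rewrite expr0.
have ux : u - d <= u <= u + d by lra.
exists true => y /near yx; rewrite -/u.
case: hs => ->.
  transitivity (z - 1); [|apply/esym]; apply: floor_def; rewrite subrK intrD;
    have := nz _ yx; have := nz _ ux; lra.
transitivity z; [|apply/esym]; apply: floor_def; rewrite intrD;
  have := nz _ yx; have := nz _ ux; lra.
Qed.

End shifted_grids.

(** * Grid cells in several dimensions *)

Section cells.
Variables (R : realType) (n : nat).
Local Notation Rn := (Rn R n).

Definition qball (x : Rn) (r : R) : set Rn :=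
  [set y | forall i, `|tnth y i - tnth x i| <= r].

Lemma measurable_box (A : 'I_n -> set R) : (forall i, measurable (A i)) ->
  measurable [set x : Rn | forall i, A i (tnth x i)].
Proof.
move=> mA; rewrite (_ : [set x | _] =
    \bigcap_(i in [set: 'I_n]) ((fun x : Rn => tnth x i) @^-1` A i)); last first.
  by apply/seteqP; split=> x /= h i => [_|]; exact: h.
apply: fin_bigcap_measurable => // i _.
rewrite -[X in measurable X]setTI.
exact: (@measurable_tnth _ (measurableTypeR R) n i measurableT _ (mA i)).
Qed.

Lemma measurable_cube (a : Rn) (l : R) : measurable (cube a l).
Proof.
apply: (@measurable_box (fun i => [set` `[tnth a i, tnth a i + l]])) => i.
exact: measurable_itv.
Qed.

Lemma qballE (x : Rn) (r : R) :
  qball x r = cube [tuple tnth x i - r | i < n] (2 * r).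
Proof.
apply/seteqP; split => y /= h i; have := h i;
  rewrite tnth_mktuple in_itv /= ler_norml => /andP[h1 h2]; lra.
Qed.

Lemma measurable_qball (x : Rn) (r : R) : measurable (qball x r).
Proof. by rewrite qballE; exact: measurable_cube. Qed.

Lemma lebesgue_qball (x : Rn) (r : R) : 0 <= r ->
  lebesgue_Rn R n (qball x r) = ((2 * r) ^+ n)%:E.
Proof. by move=> r0; rewrite qballE lebesgue_cube// mulr_ge0. Qed.

(** The integer vector of a cell is coded by a natural number, the kind of index that
    [nested_cells_trace] takes. Each coordinate has its own shift, hence 2^n grids. *)
Definition cell_index (L : R) (t : {ffun 'I_n -> bool}) (j : nat) (x : Rn) : nat :=
  pickle [ffun i => grid_index L (t i) j (tnth x i)].

Lemma cell_indexP L t j x y :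
  cell_index L t j x = cell_index L t j y <->
  forall i, grid_index L (t i) j (tnth x i) = grid_index L (t i) j (tnth y i).
Proof.
split=> [/(pcan_inj pickleK)/ffunP h i|h]; first by have := h i; rewrite !ffunE.
by congr pickle; apply/ffunP => i; rewrite !ffunE.
Qed.

Lemma cell_index_nested (L : R) t j x y : 0 < L ->
  cell_index L t j.+1 x = cell_index L t j.+1 y ->
  cell_index L t j x = cell_index L t j y.
Proof.
move=> L0 /cell_indexP h; apply/cell_indexP => i.
exact: grid_index_nested.
Qed.

Lemma measurable_cell (L : R) t j k : 0 < L ->
  measurable (cell_index L t j @^-1` [set k]).
Proof.
move=> L0; have [[x0 /= x0k]|/set0P/negP] :=
  pselect ((cell_index L t j @^-1` [set k]) !=set0);
  last by rewrite negbK => /eqP ->.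
pose c i := L / 2 ^+ j * ((grid_index L (t i) j (tnth x0 i))%:~R + grid_shift R (t i) j).
rewrite (_ : _ @^-1` _ = [set x : Rn | forall i, `[c i, c i + L / 2 ^+ j[%classic (tnth x i)]).
  by apply: (@measurable_box (fun i => [set` `[c i, c i + L / 2 ^+ j[])) => i;
    exact: measurable_itv.
apply/seteqP; split => x /=.
  rewrite -x0k => /cell_indexP h i.
  by rewrite in_itv /=; apply/grid_indexP.
move=> h; rewrite -x0k; apply/cell_indexP => i.
by apply/grid_indexP => //; have := h i; rewrite in_itv.
Qed.

Lemma cell_sub_cube (L : R) t j k : 0 < L ->
  exists a, cell_index L t j @^-1` [set k] `<=` cube a (L / 2 ^+ j).
Proof.
move=> L0; have [[x0 /= x0k]|/set0P/negP] :=
  pselect ((cell_index L t j @^-1` [set k]) !=set0);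
  last by rewrite negbK => /eqP ->; exists point; exact: sub0set.
exists [tuple L / 2 ^+ j * ((grid_index L (t i) j (tnth x0 i))%:~R +
  grid_shift R (t i) j) | i < n].
move=> x /=; rewrite -x0k => /cell_indexP h i.
have /(grid_indexP L0) /andP[h1 h2] := h i.
by rewrite tnth_mktuple in_itv /= h1 ltW.
Qed.

(** The shift is chosen coordinate by coordinate with [grid_index_local], so the grid depends on the
    ball. *)
Lemma qball_sub_cell (L : R) j (x : Rn) r : 0 < L -> 0 <= r -> 6 * r < L / 2 ^+ j ->
  exists t, qball x r `<=` cell_index L t j @^-1` [set cell_index L t j x].
Proof.
move=> L0 r0 r6.
have /choice[t tP] i := @grid_index_local R L L0 j (tnth x i) r r0 r6.
exists [ffun i => t i] => y /= h; apply/cell_indexP => i.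
by rewrite !ffunE; exact: tP.
Qed.

End cells.

(** * Products of powers and the multilinear local trace inequality *)

Lemma lee_prod_ge0 (R : realType) (I : Type) (r : seq I) (a b : I -> \bar R) :
  (forall i, 0 <= a i)%E -> (forall i, a i <= b i)%E ->
  (\prod_(i <- r) a i <= \prod_(i <- r) b i)%E.
Proof.
move=> a0 ab; suff : (0 <= \prod_(i <- r) a i <= \prod_(i <- r) b i)%E by case/andP.
elim/big_ind2 : _ => [|x1 x2 y1 y2 /andP[x0 xx] /andP[y0 yy]|i _].
- by rewrite lee01 lexx.
- by rewrite mule_ge0// lee_pmul.
- by rewrite a0 ab.
Qed.

Lemma gt0_powRD (R : realType) (K r s : R) : 0 < K ->
  K `^ (r + s) = K `^ r * K `^ s.
Proof. by move=> K0; rewrite powRD// (gt_eqF K0) implybT. Qed.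

Lemma powR_sum (R : realType) (I : finType) (K : R) (a : I -> R) : 0 < K ->
  K `^ (\sum_i a i) = \prod_i K `^ a i.
Proof.
move=> K0; elim/big_rec2 : _ => [|i y x _ <-]; first by rewrite powRr0.
by rewrite gt0_powRD.
Qed.

Lemma powR_prod (R : realType) (I : finType) (e : R) (a : I -> R) :
  (forall i, 0 <= a i) -> (\prod_i a i) `^ e = \prod_i a i `^ e.
Proof.
move=> a0; suff : 0 <= \prod_i a i /\ (\prod_i a i) `^ e = \prod_i a i `^ e by case.
elim/big_rec2 : _ => [|i y x _ [y0 <-]]; first by rewrite powR1.
by rewrite mulr_ge0// powRM.
Qed.

Lemma powR_inv_le (R : realType) (y z s : R) : 0 < s -> 0 <= y -> 0 <= z ->
  y `^ s <= z -> y <= z `^ s^-1.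
Proof.
move=> s0 y0 z0 yz.
have -> : y = (y `^ s) `^ s^-1 by rewrite -powRrM divff ?powRr1 ?gt_eqF.
by apply: ge0_ler_powR; rewrite ?invr_ge0 ?nnegrE ?powR_ge0 ?(ltW s0).
Qed.

Lemma prod_le_powR (R : realType) (m : nat) (P y E : 'I_m -> R) (p K : R) :
  (0 < m)%N -> (forall j, 0 < P j) -> p^-1 = \sum_(j < m) (P j)^-1 ->
  (forall j, 0 <= y j) -> (forall j, 0 <= E j) -> 0 <= K ->
  (forall j, y j `^ P j <= E j * K) ->
  \prod_(j < m) y j <= (\prod_(j < m) E j `^ (P j)^-1) * K `^ p^-1.
Proof.
move=> m0 P0 pP y0 E0 K0 yE.
have yE' j : y j <= E j `^ (P j)^-1 * K `^ (P j)^-1.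
  by rewrite -powRM//; apply: powR_inv_le => //; exact: mulr_ge0.
(* The rule [powR_sum] asks for a positive base; for [K = 0] some factor exists, as [0 < m], and it
   vanishes. *)
have [K_0|Kn0] := eqVneq K 0.
  rewrite (bigD1 (Ordinal m0))//=.
  have -> : y (Ordinal m0) = 0.
    apply/eqP; rewrite eq_le y0 andbT; apply: le_trans (yE' _) _.
    by rewrite K_0 powR0 ?mulr0// gt_eqF// invr_gt0.
  rewrite mul0r mulr_ge0 ?powR_ge0//.
  by apply: prodr_ge0 => j _; exact: powR_ge0.
rewrite pP powR_sum; last by rewrite lt_neqAle eq_sym Kn0.
by rewrite -big_split /=; apply: ler_prod => j _; rewrite y0 yE'.
Qed.

(** One trace constant for each grid and each function; the ratio is that of the weights side^(beta
    p / P j) between successive scales. *)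
Definition local_const (R : realType) (m n : nat) (P : 'I_m -> R) (p beta : R) : R :=
  #|{ffun 'I_n -> bool}|%:R *
  \sum_(j < m) trace_const (2 `^ (- (beta * p / P j))) (P j).

Lemma trace_const_ge0 (R : realType) (rho s : R) : 0 <= rho <= 1 -> 1 < s ->
  0 <= trace_const rho s.
Proof.
move=> /andP[rho0 rho1] s1; rewrite /trace_const mulr_ge0// divr_ge0 ?powR_ge0//.
suff : rho `^ (s - 1) <= 1 `^ (s - 1) by rewrite powR1 subr_ge0.
by apply: ge0_ler_powR; rewrite ?nnegrE ?subr_ge0 ?(ltW s1).
Qed.

(** [H] adds up the majorants that [nested_cells_trace] gives for all grids and all functions,
    divided by [E j]. Every normalised average is then controlled by the same [H x], and the product
    over [j] produces its power [p^-1], since the reciprocals of the [P j] add up to [p^-1]. *)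
Lemma local_trace (R : realType) (m n : nat) (P : 'I_m -> R) (p beta M l : R)
    (mu : {measure set (Rn R n) -> \bar R}) (f : 'I_m -> Rn R n -> R)
    (S : set (Rn R n)) (E : 'I_m -> R) :
  (0 < m)%N -> (forall j, 1 < P j) -> p^-1 = \sum_(j < m) (P j)^-1 -> 0 < p ->
  0 < beta -> beta <= (m * n)%:R -> 0 <= M -> 0 < l ->
  (forall (a : Rn R n) (l' : R), (0 < l')%R ->
    mu (cube a l') <= (M * l' `^ (n%:R - beta * p))%:E)%E ->
  measurable S -> (forall j, measurable_fun setT (f j)) ->
  (forall j x, 0 <= f j x) -> (forall j, 0 < E j) ->
  (forall j, \int[lebesgue_Rn R n]_(y in S) (f j y `^ P j)%:E = (E j)%:E)%E ->
  exists H : Rn R n -> \bar R, [/\ measurable_fun setT H, (forall x, 0 <= H x)%E,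
    (forall (x : Rn R n) (r : R), (0 < r)%R -> (r <= l)%R -> qball x r `<=` S ->
      \prod_(j < m) \int[lebesgue_Rn R n]_(y in qball x r) (f j y)%:E <=
      ((24 * r) `^ ((m * n)%:R - beta))%:E * H x `^ p^-1)%E &
    (\int[mu]_x H x <=
      (local_const n P p beta * M * \prod_(j < m) E j `^ (p / P j))%:E)%E].
Proof.
move=> m0 P1 pP p0 b0 bmn M0 l0 muM mS mf f0 E0 fE.
have P0 j : 0 < P j by exact: lt_trans (P1 j).
pose g j y := f j y * \1_S y.
have g0 j y : 0 <= g j y by rewrite mulr_ge0.
have mg j : measurable_fun setT (g j).
  by apply: measurable_funM => //; exact: measurable_indic.
have gE j : (\int[lebesgue_Rn R n]_y (g j y `^ P j)%:E = (E j)%:E)%E.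
  rewrite -fE [RHS]integral_mkcond; apply: eq_integral => y _.
  rewrite patchE /g indicE; case: ifPn => yS; first by rewrite mulr1.
  by rewrite mulr0 powR0// gt_eqF.
(* With top side [12 * l], a radius in the shell [l / 2 ^+ i.+1 < r <= l / 2 ^+ i] has
   [12 * r <= side i < 24 * r]: the ball fits in a cell of some grid, of comparable size. *)
have L0 : 0 < 12 * l by rewrite mulr_gt0.
pose side j : R := 12 * l / 2 ^+ j.
have side0 j : 0 < side j by rewrite divr_gt0 ?exprn_gt0.
(* These exponents add up to [beta], and side^(e j) to the power [- P j] is side^(-beta p), so the
   hypothesis of [nested_cells_trace] on [mu] becomes growth of order n - beta p. *)
pose e j := beta * p / P j.
have e0 j : 0 < e j by rewrite divr_gt0 ?mulr_gt0.
pose rho j : R := 2 `^ (- e j).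
have rho0 j : 0 < rho j by rewrite powR_gt0.
have rho1 j : rho j < 1.
  rewrite /rho powRN invf_lt1 ?powR_gt0//.
  suff : 1 `^ e j < 2 `^ e j by rewrite powR1.
  by apply: gt0_ltr_powR; rewrite ?nnegrE ?ltr1n.
have /choice[H HP] (tj : {ffun 'I_n -> bool} * 'I_m) : exists H : Rn R n -> \bar R,
    [/\ measurable_fun setT H, (forall x, 0 <= H x)%E,
    (forall i x, ((side i `^ e tj.2 / side i ^+ n)%:E *
       \int[lebesgue_Rn R n]_(y in cell_index (12 * l) tj.1 i @^-1`
         [set cell_index (12 * l) tj.1 i x]) (g tj.2 y)%:E) `^ P tj.2 <= H x)%E &
    (\int[mu]_x H x <= (trace_const (rho tj.2) (P tj.2) * M)%:E *
      \int[lebesgue_Rn R n]_x (g tj.2 x `^ P tj.2)%:E)%E].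
  case: tj => t j /=.
  apply: (@nested_cells_trace _ _ R mu (lebesgue_Rn R n)
    (cell_index (12 * l) t) (fun i => side i ^+ n) (fun i => side i `^ e j)
    (rho j) (P j) M (g j)) => //.
  - by move=> i k; exact: measurable_cell.
  - by move=> i x y; exact: cell_index_nested.
  - by move=> i; rewrite exprn_gt0.
  - by move=> i; rewrite powR_gt0.
  - move=> i; have -> : side i.+1 = 2^-1 * side i.
      by rewrite /side exprS; field; rewrite expf_neq0.
    by rewrite powRM ?invr_ge0 ?(ltW (side0 i))// /rho -powR_inv1// -powRrM mulN1r.
  - move=> i k; have [a sub] := cell_sub_cube t i k L0.
    rewrite -(lebesgue_cube a (ltW (side0 i))).
    by apply: le_measure => //; rewrite inE; [exact: measurable_cell|exact: measurable_cube].
  - move=> i k; have [a sub] := cell_sub_cube t i k L0.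
    apply: (@le_trans _ _ (mu (cube a (side i)))).
      by apply: le_measure => //; rewrite inE; [exact: measurable_cell|exact: measurable_cube].
    apply: (le_trans (muM _ _ (side0 i))).
    rewrite -powRrM /e mulrN divfK ?gt_eqF// gt0_powRD//.
    by rewrite powR_mulrn// ltW.
  - by rewrite gE ltry.
have mH tj : measurable_fun setT (H tj) by have [] := HP tj.
have H0 tj x : (0 <= H tj x)%E by have [] := HP tj.
pose EE := \prod_(j < m) E j `^ (p / P j).
have EE0 : 0 < EE by apply: prodr_gt0 => j _; rewrite powR_gt0.
(* The weight [EE / E j] turns the bound by [E j] on each integral into the common bound by [EE]. *)
pose Hs x := (\sum_tj (EE / E tj.2)%:E * H tj x)%E.
have wH0 tj x : (0 <= (EE / E tj.2)%:E * H tj x)%E.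
  by rewrite mule_ge0// lee_fin divr_ge0// ltW.
exists Hs; split.
- by apply: emeasurable_sum => tj; exact: measurable_funeM.
- by move=> x; exact: sume_ge0.
- move=> x r r0 rl qS.
  have Hs0 : (0 <= Hs x)%E by exact: sume_ge0.
  have mnb : 0 <= (m * n)%:R - beta by rewrite subr_ge0.
  have r24 : 0 < (24 * r) `^ ((m * n)%:R - beta) by rewrite powR_gt0// mulr_gt0.
  have [Hoo|Hfin] := eqVneq (Hs x) +oo%E.
    by rewrite Hoo poweRyr ?gt_eqF ?invr_gt0// gt0_muley ?lte_fin ?leey.
  have [i /andP[ri ir]] := dyadic_shell r0 rl.
  have sr : 12 * r <= side i by rewrite /side -mulrA ler_pM2l.
  have rs : side i < 24 * r.
    move: ri; rewrite exprS invfM mulrA mulrAC ltr_pdivrMr// /side -mulrA; lra.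
  have [t tsub] := @qball_sub_cell R n (12 * l) i x r L0 (ltW r0)
    ltac:(rewrite -/(side i); lra).
  set cell := _ @^-1` _ in tsub.
  pose X j := (\int[lebesgue_Rn R n]_(y in cell) (g j y)%:E)%E.
  have X0 j : (0 <= X j)%E by apply: integral_ge0 => y _; rewrite lee_fin.
  have qX j : (\int[lebesgue_Rn R n]_(y in qball x r) (f j y)%:E <= X j)%E.
    apply: (@le_trans _ _ (\int[lebesgue_Rn R n]_(y in qball x r) (g j y)%:E)%E).
      apply: ge0_le_integral_any => y qy; first by rewrite lee_fin.
      by rewrite lee_fin /g indicE mem_set ?mulr1//; exact: qS.
    apply: ge0_subset_integral => //.
    - exact: measurable_qball.
    - exact: measurable_cell.
    - by apply/measurable_EFinP; exact: measurable_funTS.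
    - by move=> y _; rewrite lee_fin.
  pose eta := fine (Hs x).
  have HsE : Hs x = eta%:E by rewrite /eta fineK// ge0_fin_numE// ltey.
  have eta0 : 0 <= eta by exact: fine_ge0.
  have XH j : (((side i `^ e j / side i ^+ n)%:E * X j) `^ P j <=
      (E j / EE * eta)%:E)%E.
    have [_ _ h _] := HP (t, j); apply: (le_trans (h i x)) => /=.
    have : ((EE / E j)%:E * H (t, j) x <= eta%:E)%E.
      rewrite -HsE /Hs (bigD1 (t, j))//= leeDl// sume_ge0// => tj _; exact: wH0.
    move=> hE; rewrite EFinM -[leLHS]mul1e.
    have -> : (1 = (E j / EE)%:E * (EE / E j)%:E :> \bar R)%E.
      by rewrite -EFinM; congr EFin; field; rewrite !gt_eqF.
    rewrite -muleA lee_wpmul2l// lee_fin divr_ge0// ltW//.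
  have c0 j : 0 < side i `^ e j / side i ^+ n by rewrite divr_gt0 ?powR_gt0 ?exprn_gt0.
  have Xfin j : X j \is a fin_num.
    rewrite ge0_fin_numE// ltey; apply: contraTneq (XH j) => ->.
    by rewrite gt0_muley ?lte_fin// poweRyr ?gt_eqF// leye_eq.
  pose y j := fine (X j) / side i ^+ n.
  have y0 j : 0 <= y j by rewrite divr_ge0 ?fine_ge0 ?exprn_ge0 ?(ltW (side0 i)).
  have XE j : X j = (side i ^+ n * y j)%:E.
    by rewrite /y mulrC divfK ?fineK// expf_neq0// gt_eqF.
  apply: (@le_trans _ _ (\prod_(j < m) (X j))%E).
    apply: lee_prod_ge0 => j; last exact: qX.
    by apply: integral_ge0 => z _; rewrite lee_fin.
  rewrite HsE poweR_EFin (eq_bigr (fun j => (side i ^+ n * y j)%:E)) => [|j _]; last exact: XE.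
  rewrite prodEFin -EFinM lee_fin big_split /= prodr_const card_ord.
  (* The factor beside [E j] is the same for all [j], the form that [prod_le_powR] takes. *)
  have yK j : y j `^ P j <= E j * (side i `^ (- (beta * p)) * eta / EE).
    have := XH j; rewrite XE -EFinM poweR_EFin lee_fin.
    have -> : side i `^ e j / side i ^+ n * (side i ^+ n * y j) = side i `^ e j * y j.
      by field; rewrite expf_neq0// gt_eqF.
    rewrite powRM ?powR_ge0// -powRrM /e divfK ?gt_eqF// => h.
    rewrite powRN.
    have -> : E j * ((side i `^ (beta * p))^-1 * eta / EE) =
              (E j / EE * eta) / side i `^ (beta * p).
      by field; rewrite !gt_eqF ?powR_gt0.
    by rewrite ler_pdivlMr ?powR_gt0// mulrC.
  have K0 : 0 <= side i `^ (- (beta * p)) * eta / EE.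
    by rewrite divr_ge0 ?mulr_ge0 ?powR_ge0// ltW.
  have := prod_le_powR m0 P0 pP y0 (fun j => ltW (E0 j)) K0 yK.
  have -> : (side i `^ (- (beta * p)) * eta / EE) `^ p^-1 =
      side i `^ (- beta) * eta `^ p^-1 / \prod_(j < m) E j `^ (P j)^-1.
    rewrite powRM ?mulr_ge0 ?powR_ge0 ?invr_ge0 ?(ltW EE0)//.
    rewrite powRM ?powR_ge0// -powRrM mulNr mulfK ?gt_eqF//.
    congr (_ * _); rewrite -powR_inv1 ?(ltW EE0)// -powRrM mulrC powRrM powR_inv1 ?powR_ge0//.
    congr (_^-1); rewrite powR_prod; last by move=> j; exact: powR_ge0.
    by apply: eq_bigr => j _; rewrite -powRrM mulrAC divff ?mul1r// gt_eqF.
  have PE0 : 0 < \prod_(j < m) E j `^ (P j)^-1 by apply: prodr_gt0 => j _; rewrite powR_gt0.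
  rewrite mulrCA mulfV ?gt_eqF// mulr1 => yle.
  have sn0 : 0 <= side i ^+ n ^+ m by rewrite !exprn_ge0// ltW.
  apply: (le_trans (ler_wpM2l sn0 yle)).
  rewrite mulrA ler_wpM2r ?powR_ge0//.
  have -> : side i ^+ n ^+ m * side i `^ (- beta) = side i `^ ((m * n)%:R - beta).
    rewrite gt0_powRD//.
    by rewrite powR_mulrn ?ltW// -exprM mulnC.
  by apply: ge0_ler_powR => //; rewrite ?nnegrE ?ltW// mulr_gt0.
- rewrite ge0_integral_sum//; last first.
    by move=> tj; exact: measurable_funeM.
  apply: (@le_trans _ _ (\sum_(tj : {ffun 'I_n -> bool} * 'I_m)
      (EE * M * trace_const (rho tj.2) (P tj.2))%:E)%E).
    apply: lee_sum => tj _; rewrite ge0_integralZl_EFin//; last first.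
      by rewrite divr_ge0// ltW.
    have [_ _ _ h] := HP tj.
    apply: (le_trans (lee_wpmul2l _ h)); first by rewrite lee_fin divr_ge0// ltW.
    rewrite gE -!EFinM lee_fin le_eqVlt; apply/orP; left; apply/eqP.
    by field; rewrite gt_eqF.
  rewrite sumEFin lee_fin -mulr_sumr.
  rewrite -(pair_bigA _ (fun (t : {ffun 'I_n -> bool}) j => trace_const (rho j) (P j))) /=.
  rewrite sumr_const -/EE /local_const -/(rho _) le_eqVlt; apply/orP; left; apply/eqP.
  by rewrite -mulr_natl; ring.
Qed.

(** * Shell decomposition of the kernel *)

Section kernel.
Variables (R : realType) (m n : nat).
Local Notation Rn := (Rn R n).

(* An unqualified [edist] is the distance of pseudometric spaces. *)
Lemma edistE (x y : Rn) :
  Defs.edist x y = (\sum_(i < n) (tnth x i - tnth y i) ^+ 2) `^ 2^-1.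
Proof. by rewrite powR12_sqrt// sumr_ge0// => i _; exact: sqr_ge0. Qed.

Lemma edist_ge0 (x y : Rn) : 0 <= Defs.edist x y.
Proof. by rewrite edistE powR_ge0. Qed.

Lemma edist_ge_coord (x y : Rn) i : `|tnth y i - tnth x i| <= Defs.edist x y.
Proof.
rewrite distrC -sqrtr_sqr ler_sqrt; last by apply: sumr_ge0 => j _; exact: sqr_ge0.
by rewrite (bigD1 i)//= lerDl sumr_ge0// => j _; exact: sqr_ge0.
Qed.

Definition kernel_integrand (alpha : R) (f : 'I_m -> Rn -> R) (x : Rn)
    (y : m.-tuple Rn) : R :=
  (\prod_(j < m) f j (tnth y j)) /
  (\sum_(j < m) Defs.edist x (tnth y j)) `^ ((m * n)%:R - alpha).

Lemma measurable_kernel_integrand (alpha : R) (f : 'I_m -> Rn -> R) :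
  (forall j, measurable_fun setT (f j)) ->
  measurable_fun setT (fun z : Rn * m.-tuple Rn => kernel_integrand alpha f z.1 z.2).
Proof.
move=> mf; apply: measurable_funM.
  apply: measurable_prod => j _; apply: (measurableT_comp (mf j)).
  apply: (measurableT_comp (f := fun y : m.-tuple Rn => tnth y j)) => //.
  exact: measurable_tnth.
under eq_fun do rewrite -powRN.
apply: (measurableT_comp (measurable_powR _)).
apply: measurable_sum => j; under eq_fun do rewrite edistE.
apply: (measurableT_comp (measurable_powR _)).
apply: measurable_sum => i; apply: measurable_funX; apply: measurable_funB.
  apply: (measurableT_comp (f := fun x : Rn => tnth x i)) => //.
  exact: measurable_tnth.
apply: (measurableT_comp (f := fun x : Rn => tnth x i)).
  exact: measurable_tnth.
apply: (measurableT_comp (f := fun y : m.-tuple Rn => tnth y j)) => //.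
exact: measurable_tnth.
Qed.

(** The integrand may fail to be integrable, so Tonelli's theorem is applied to its positive and
    negative parts separately. *)
Lemma measurable_frac_integral (alpha : R) (f : 'I_m -> Rn -> R) :
  (forall j, measurable_fun setT (f j)) ->
  measurable_fun setT (frac_integral alpha f).
Proof.
move=> mf; have /measurable_EFinP mk := measurable_kernel_integrand alpha mf.
rewrite (_ : frac_integral alpha f = (fun x =>
    \int[tuple_measure (lebesgue_Rn R n) m]_y
      ((fun z => (kernel_integrand alpha f z.1 z.2)%:E)^\+ (x, y)) -
    \int[tuple_measure (lebesgue_Rn R n) m]_y
      ((fun z => (kernel_integrand alpha f z.1 z.2)%:E)^\- (x, y)))%E); last first.
  apply/funext => x; rewrite /frac_integral integralE.
  by congr (_ - _)%E; apply: eq_integral => y _; rewrite ?funeposE ?funenegE.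
apply: emeasurable_funB; apply: measurable_fun_fubini_tonelli_F => //.
- exact: measurable_funepos.
- exact: measurable_funeneg.
Qed.

Definition ball_prod (f : 'I_m -> Rn -> R) (x : Rn) (r : R) : \bar R :=
  (\prod_(j < m) \int[lebesgue_Rn R n]_(y in qball x r) `|f j y|%:E)%E.

Definition ball_term (f : 'I_m -> Rn -> R) (x : Rn) (r : R) (y : m.-tuple Rn) : R :=
  \prod_(j < m) (`|f j (tnth y j)| * \1_(qball x r) (tnth y j)).

Lemma ball_term_ge0 f x r y : 0 <= ball_term f x r y.
Proof. by apply: prodr_ge0 => j _; rewrite mulr_ge0. Qed.

Lemma measurable_ball_term f x r : (forall j, measurable_fun setT (f j)) ->
  measurable_fun setT (ball_term f x r).
Proof.
move=> mf; apply: measurable_prod => j _.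
apply: (measurableT_comp (f := fun y : Rn => `|f j y| * \1_(qball x r) y)).
  apply: measurable_funM; first exact: measurableT_comp.
  by apply: measurable_indic; exact: measurable_qball.
exact: measurable_tnth.
Qed.

Lemma integral_ball_term f x r : (forall j, measurable_fun setT (f j)) ->
  (\int[tuple_measure (lebesgue_Rn R n) m]_y (ball_term f x r y)%:E = ball_prod f x r)%E.
Proof.
move=> mf; under eq_integral do rewrite -prodEFin.
rewrite (@integral_tuple_prod _ _ _ (lebesgue_Rn R n) m
  (fun j y => (`|f j y| * \1_(qball x r) y)%:E)); last 2 first.
- move=> j; apply/measurable_EFinP; apply: measurable_funM; first exact: measurableT_comp.
  by apply: measurable_indic; exact: measurable_qball.
- by move=> j y; rewrite lee_fin mulr_ge0.
apply: eq_bigr => j _; rewrite [RHS]integral_mkcond; apply: eq_integral => y _.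
by rewrite patchE indicE; case: ifPn => _; rewrite ?mulr1// mulr0.
Qed.

(** A single term suffices for each tuple, that of the shell of [s], the sum of the distances to
    [x]: the kernel is at most the power of the inner radius, and all entries lie in the ball of the
    outer one. *)
Lemma kernel_integrand_le_shells (alpha delta : R) f x y :
  alpha < (m * n)%:R -> 0 < delta ->
  (`|kernel_integrand alpha f x y|%:E <=
    \sum_(0 <= i <oo) ((delta / 2 ^+ i.+1) `^ (- ((m * n)%:R - alpha)) *
      ball_term f x (delta / 2 ^+ i) y)%:E +
    \sum_(0 <= i <oo) ((delta * 2 ^+ i) `^ (- ((m * n)%:R - alpha)) *
      ball_term f x (delta * 2 ^+ i.+1) y)%:E)%E.
Proof.
move=> amn d0; have : 0 < (m * n)%:R - alpha by rewrite subr_gt0.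
rewrite /kernel_integrand; move: (_ - alpha) => e e0.
set S1 := (X in (_ <= X + _)%E); set S2 := (X in (_ <= _ + X)%E).
have term0 c r : (0 <= (c `^ (- e) * ball_term f x r y)%:E)%E.
  by rewrite lee_fin mulr_ge0 ?powR_ge0 ?ball_term_ge0.
have S10 : (0 <= S1)%E by apply: nneseries_ge0 => *; exact: term0.
have S20 : (0 <= S2)%E by apply: nneseries_ge0 => *; exact: term0.
set s := \sum_(j < m) _.
have s0 : 0 <= s by apply: sumr_ge0 => j _; exact: edist_ge0.
(* At [s = 0] the quotient is 0 by convention: the power of 0 is 0, and so is its inverse. *)
have [->|sn0] := eqVneq s 0.
  by rewrite powR0 ?gt_eqF// invr0 mulr0 normr0 adde_ge0.
have sgt0 : 0 < s by rewrite lt_neqAle eq_sym sn0.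
have ball_termE (r : R) : s <= r -> ball_term f x r y = `|\prod_(j < m) f j (tnth y j)|.
  move=> sr; rewrite normr_prod; apply: eq_bigr => j _.
  rewrite indicE mem_set ?mulr1// => i; apply: le_trans (edist_ge_coord _ _ _) _.
  apply: le_trans sr; rewrite /s (bigD1 j)//= lerDl sumr_ge0// => k _.
  exact: edist_ge0.
rewrite normrM (ger0_norm (x := (s `^ e)^-1)) ?invr_ge0 ?powR_ge0//.
have term_ge (c r : R) : 0 < c -> c <= s -> s <= r ->
    ((`|\prod_(j < m) f j (tnth y j)| / s `^ e)%:E <=
     (c `^ (- e) * ball_term f x r y)%:E)%E.
  move=> c0 cs sr; rewrite lee_fin ball_termE// mulrC ler_wpM2r// powRN.
  rewrite lef_pV2 ?posrE ?powR_gt0//.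
  by apply: ge0_ler_powR; rewrite ?nnegrE ?(ltW e0) ?(ltW c0).
have single (u : nat -> \bar R) i : (forall k, 0 <= u k)%E ->
    (u i <= \sum_(0 <= k <oo) u k)%E.
  move=> u0; apply: (@le_trans _ _ (\sum_(0 <= k < i.+1) u k)%E).
    by rewrite big_nat_recr//= leeDr// sume_ge0.
  exact: nneseries_lim_ge.
have [sd|ds] := leP s delta.
  have [i /andP[h1 h2]] := dyadic_shell sgt0 sd.
  apply: le_trans (leeDl _ S20).
  apply: le_trans (single (fun i => ((delta / 2 ^+ i.+1) `^ (- e) *
     ball_term f x (delta / 2 ^+ i) y)%:E) i _); last by move=> k; exact: term0.
  by apply: term_ge => //; [rewrite divr_gt0 ?exprn_gt0|exact: ltW].
(* The far shells come from [dyadic_shell] applied to reciprocals. *)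
have si0 : 0 < s^-1 by rewrite invr_gt0.
have sdi : s^-1 <= delta^-1 by rewrite lef_pV2 ?posrE ?(ltW ds).
have [i /andP[h1 h2]] := dyadic_shell si0 sdi.
apply: le_trans (leeDr _ S10).
apply: le_trans (single (fun i => ((delta * 2 ^+ i) `^ (- e) *
   ball_term f x (delta * 2 ^+ i.+1) y)%:E) i _); last by move=> k; exact: term0.
apply: term_ge; first by rewrite mulr_gt0 ?exprn_gt0.
  by rewrite -lef_pV2 ?posrE ?mulr_gt0 ?exprn_gt0// invfM.
by rewrite -lef_pV2 ?posrE ?mulr_gt0 ?exprn_gt0// invfM ltW.
Qed.

Lemma frac_integral_le_shells (alpha delta : R) f x :
  (forall j, measurable_fun setT (f j)) -> alpha < (m * n)%:R -> 0 < delta ->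
  (`|frac_integral alpha f x| <=
    \sum_(0 <= i <oo) ((delta / 2 ^+ i.+1) `^ (- ((m * n)%:R - alpha)))%:E *
      ball_prod f x (delta / 2 ^+ i) +
    \sum_(0 <= i <oo) ((delta * 2 ^+ i) `^ (- ((m * n)%:R - alpha)))%:E *
      ball_prod f x (delta * 2 ^+ i.+1))%E.
Proof.
move=> mf amn d0; set e := (m * n)%:R - alpha.
have mt r : measurable_fun setT (fun y => (ball_term f x r y)%:E).
  by apply/measurable_EFinP; exact: measurable_ball_term.
have mc c r : measurable_fun setT (fun y => (c `^ (- e) * ball_term f x r y)%:E).
  by apply/measurable_EFinP; apply: measurable_funM => //; exact: measurable_ball_term.
have c0 c r y : (0 <= (c `^ (- e) * ball_term f x r y)%:E)%E.
  by rewrite lee_fin mulr_ge0 ?powR_ge0 ?ball_term_ge0.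
have sE (c r : nat -> R) :
    (\sum_(0 <= i <oo) ((c i) `^ (- e))%:E * ball_prod f x (r i) =
     \int[tuple_measure (lebesgue_Rn R n) m]_y
        \sum_(0 <= i <oo) ((c i) `^ (- e) * ball_term f x (r i) y)%:E)%E.
  rewrite integral_nneseries//; apply: eq_eseriesr => i _.
  under eq_integral do rewrite EFinM.
  rewrite ge0_integralZl_EFin ?powR_ge0//; last by move=> y _; rewrite lee_fin ball_term_ge0.
  by rewrite integral_ball_term.
rewrite (sE (fun i => delta / 2 ^+ i.+1) (fun i => delta / 2 ^+ i)).
rewrite (sE (fun i => delta * 2 ^+ i) (fun i => delta * 2 ^+ i.+1)).
rewrite -ge0_integralD//; last 4 first.
- by move=> y _; apply: nneseries_ge0 => *; exact: c0.
- by apply: ge0_emeasurable_sum => *.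
- by move=> y _; apply: nneseries_ge0 => *; exact: c0.
- by apply: ge0_emeasurable_sum => *.
apply: (le_trans (le_abse_integral _ _ _)) => //.
  apply/measurable_EFinP.
  exact: (measurable_fun_pair2 x (measurable_kernel_integrand alpha mf)).
apply: ge0_le_integral_any => // y _.
exact: kernel_integrand_le_shells.
Qed.

End kernel.

(** * Hedberg's inequality and the Morrey bound on balls *)

Section pointwise.
Variables (R : realType) (m n : nat).
Local Notation Rn := (Rn R n).

Lemma ball_prod_ge0 (f : 'I_m -> Rn -> R) x r : (0 <= ball_prod f x r)%E.
Proof. by apply: prode_ge0 => j _; apply: integral_ge0. Qed.

Lemma frac_integral_eq0 (alpha : R) (f : 'I_m -> Rn -> R) x :
  (forall j, measurable_fun setT (f j)) -> alpha < (m * n)%:R ->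
  (forall r, 0 < r -> ball_prod f x r = 0%E) -> frac_integral alpha f x = 0%E.
Proof.
move=> mf amn B0; apply/eqP; rewrite -abse_eq0 eq_le abse_ge0 andbT.
apply: (le_trans (frac_integral_le_shells x mf amn ltr01)).
by rewrite !eseries0 ?adde0// => i _ _; rewrite B0 ?mule0// ?mulr_gt0 ?divr_gt0 ?exprn_gt0.
Qed.

(** The sums of the near and the far geometric series, of ratios 2^(beta - alpha) and 2^(alpha -
    kappa); [kappa] will be n/p0. *)
Definition hedberg_const (alpha beta kappa : R) : R :=
  2 `^ ((m * n)%:R - alpha) / (1 - 2^-1 `^ (alpha - beta)) +
  2 `^ ((m * n)%:R - kappa) / (1 - 2 `^ (alpha - kappa)).

Lemma powR_exprn (x a : R) i : 0 <= x -> (x ^+ i) `^ a = (x `^ a) ^+ i.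
Proof. by move=> x0; rewrite -powR_mulrn// powRAC powR_mulrn ?powR_ge0. Qed.

Lemma powR_lt1 (x a : R) : 0 < x < 1 -> 0 < a -> x `^ a < 1.
Proof.
move=> /andP[x0 x1] a0; suff : x `^ a < 1 `^ a by rewrite powR1.
by apply: gt0_ltr_powR; rewrite ?nnegrE ?(ltW x0).
Qed.

Lemma hedberg_const_gt0 (alpha beta kappa : R) :
  beta < alpha -> alpha < kappa -> 0 < hedberg_const alpha beta kappa.
Proof.
move=> ba ak; rewrite addr_gt0// divr_gt0 ?powR_gt0// subr_gt0.
  by rewrite powR_lt1 ?subr_gt0// invr_gt0 ltr0n /= invf_lt1 ?ltr1n.
rewrite -(opprB kappa) powRN invf_lt1 ?powR_gt0//.
suff : 1 `^ (kappa - alpha) < 2 `^ (kappa - alpha) :> R by rewrite powR1.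
by apply: gt0_ltr_powR; rewrite ?nnegrE ?subr_gt0 ?ltr1n.
Qed.

(* Hedberg's trick: the radius [delta] balances the near and the far shells. *)
Lemma frac_integral_hedberg (alpha beta kappa N K : R) (f : 'I_m -> Rn -> R) x :
  (forall j, measurable_fun setT (f j)) -> alpha < (m * n)%:R ->
  beta < alpha -> alpha < kappa -> 0 < N -> 0 < K ->
  (forall r, 0 < r -> (ball_prod f x r <= (N * r `^ ((m * n)%:R - beta))%:E)%E) ->
  (forall r, 0 < r -> (ball_prod f x r <= (K * r `^ ((m * n)%:R - kappa))%:E)%E) ->
  (`|frac_integral alpha f x| <= (hedberg_const alpha beta kappa *
    (N `^ ((kappa - alpha) / (kappa - beta)) *
     K `^ ((alpha - beta) / (kappa - beta))))%:E)%E.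
Proof.
move=> mf amn ba ak N0 K0 BN BK.
have kb0 : 0 < kappa - beta by lra.
(* This radius solves N delta^(alpha - beta) = K delta^(alpha - kappa), and [Q] below is the common
   value. *)
pose delta := (K / N) `^ (kappa - beta)^-1.
have KN0 : 0 < K / N by rewrite divr_gt0.
have d0 : 0 < delta by rewrite powR_gt0.
have dE c : delta `^ c = K `^ (c / (kappa - beta)) * N `^ (- (c / (kappa - beta))).
  rewrite /delta -powRrM (mulrC _ c) powRM ?invr_ge0 ?(ltW K0) ?(ltW N0)//.
  by rewrite -(powR_inv1 (ltW N0)) -powRrM mulN1r.
set Q := _ * _ `^ _.
have nearE : N * delta `^ (alpha - beta) = Q.
  rewrite dE mulrCA; rewrite mulrC /Q; congr (_ * _).
  rewrite -{1}(powRr1 (ltW N0)) -gt0_powRD//; congr (_ `^ _).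
  by field; rewrite gt_eqF.
have farE : K * delta `^ (alpha - kappa) = Q.
  rewrite dE mulrA /Q mulrC; congr (_ * _).
    by congr (_ `^ _); rewrite -mulNr opprB.
  rewrite -{1}(powRr1 (ltW K0)) -gt0_powRD//; congr (_ `^ _).
  by field; rewrite gt_eqF.
have Q0 : 0 < Q by rewrite mulr_gt0 ?powR_gt0.
apply: (le_trans (frac_integral_le_shells x mf amn d0)).
rewrite /hedberg_const mulrDl EFinD; apply: leeD.
- pose z : R := 2^-1 `^ (alpha - beta).
  have z01 : 0 < z < 1.
    by rewrite /z powR_gt0// powR_lt1 ?subr_gt0// invr_gt0 ltr0n /= invf_lt1 ?ltr1n.
  apply: (@le_trans _ _ (\sum_(0 <= i <oo)
      (2 `^ ((m * n)%:R - alpha) * Q * z ^+ i)%:E)%E); last first.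
    apply: (le_trans (nneseries_geometric_le _ _ _)); rewrite ?mulr_ge0 ?powR_ge0 ?(ltW Q0)//;
      try by case/andP: z01.
    by rewrite lee_fin mulrAC.
  apply: lee_nneseries => i *.
    rewrite mule_ge0 ?lee_fin ?powR_ge0//.
    exact: ball_prod_ge0.
  have r0 : 0 < delta / 2 ^+ i by rewrite divr_gt0 ?exprn_gt0.
  apply: (le_trans (lee_wpmul2l _ (BN _ r0))); first by rewrite lee_fin powR_ge0.
  rewrite -EFinM lee_fin le_eqVlt; apply/orP; left; apply/eqP.
  rewrite -nearE.
  have -> : delta / 2 ^+ i.+1 = delta / 2 ^+ i * 2^-1.
    by rewrite exprS invfM mulrCA mulrC.
  have zE : (delta / 2 ^+ i) `^ (alpha - beta) = delta `^ (alpha - beta) * z ^+ i.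
    by rewrite powRM ?(ltW d0) ?invr_ge0 ?exprn_ge0// -exprVn powR_exprn// invr_ge0.
  have -> : 2 `^ ((m * n)%:R - alpha) = 2^-1 `^ (- ((m * n)%:R - alpha)) :> R.
    by rewrite -powR_inv1// -powRrM mulN1r opprK.
  rewrite powRM ?(ltW r0) ?invr_ge0//.
  have e1 : (delta / 2 ^+ i) `^ (- ((m * n)%:R - alpha)) *
      (delta / 2 ^+ i) `^ ((m * n)%:R - beta) = delta `^ (alpha - beta) * z ^+ i.
    by rewrite -zE -gt0_powRD//; congr (_ `^ _); ring.
  rewrite mulrACA; rewrite [in RHS]mulrA -[RHS]mulrA -e1; ring.
- pose z : R := 2 `^ (alpha - kappa).
  have z01 : 0 < z < 1.
    rewrite /z powR_gt0//= -(opprB kappa) powRN invf_lt1 ?powR_gt0//.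
    suff : 1 `^ (kappa - alpha) < 2 `^ (kappa - alpha) :> R by rewrite powR1.
    by apply: gt0_ltr_powR; rewrite ?nnegrE ?subr_gt0 ?ltr1n.
  apply: (@le_trans _ _ (\sum_(0 <= i <oo)
      (2 `^ ((m * n)%:R - kappa) * Q * z ^+ i)%:E)%E); last first.
    apply: (le_trans (nneseries_geometric_le _ _ _)); rewrite ?mulr_ge0 ?powR_ge0 ?(ltW Q0)//;
      try by case/andP: z01.
    by rewrite lee_fin mulrAC.
  apply: lee_nneseries => i *.
    rewrite mule_ge0 ?lee_fin ?powR_ge0//.
    exact: ball_prod_ge0.
  have r0 : 0 < delta * 2 ^+ i.+1 by rewrite mulr_gt0 ?exprn_gt0.
  have r1 : 0 < delta * 2 ^+ i by rewrite mulr_gt0 ?exprn_gt0.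
  apply: (le_trans (lee_wpmul2l _ (BK _ r0))); first by rewrite lee_fin powR_ge0.
  rewrite -EFinM lee_fin le_eqVlt; apply/orP; left; apply/eqP.
  rewrite -farE.
  have -> : delta * 2 ^+ i.+1 = 2 * (delta * 2 ^+ i) by rewrite exprS mulrCA.
  have zE : (delta * 2 ^+ i) `^ (alpha - kappa) = delta `^ (alpha - kappa) * z ^+ i.
    by rewrite powRM ?(ltW d0) ?exprn_ge0// powR_exprn.
  rewrite (powRM _ _ (ltW r1))//.
  have e1 : (delta * 2 ^+ i) `^ (- ((m * n)%:R - alpha)) *
      (delta * 2 ^+ i) `^ ((m * n)%:R - kappa) = delta `^ (alpha - kappa) * z ^+ i.
    by rewrite -zE -gt0_powRD//; congr (_ `^ _); ring.
  by rewrite mulrCA (mulrCA _ (2 `^ _)) e1; ring.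
Qed.

Lemma prode_cst (I : finType) (c : R) (a : I -> \bar R) :
  (\prod_i (c%:E * a i) = (c ^+ #|I|)%:E * \prod_i a i)%E.
Proof. by rewrite big_split /= prodEFin prodr_const. Qed.

Lemma volumeE (a : Rn) (l : R) : 0 <= l -> volume a l = l ^+ n.
Proof. by move=> l0; rewrite /volume lebesgue_cube. Qed.

(** Jensen's inequality in each factor replaces averages by means of order [P j], whose product the
    Morrey norm bounds on the cube of side [2 * r]. *)
Lemma ball_prod_le_morrey (P : 'I_m -> R) (p0 : R) (f : 'I_m -> Rn -> R) x r :
  (forall j, measurable_fun setT (f j)) -> (forall j, 1 < P j) -> 0 < r ->
  (ball_prod f x r <=
    ((2 * r) `^ ((m * n)%:R - n%:R / p0))%:E * morrey_norm P p0 f)%E.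
Proof.
move=> mf P1 r0; set V := (2 * r) ^+ n.
have r20 : 0 < 2 * r by rewrite mulr_gt0.
have V0 : 0 < V by rewrite exprn_gt0.
pose A j := ((V^-1)%:E * \int[lebesgue_Rn R n]_(y in qball x r) (`|f j y| `^ P j)%:E)%E.
have A0 j : (0 <= A j)%E.
  rewrite mule_ge0 ?lee_fin ?invr_ge0 ?(ltW V0)//.
  by apply: integral_ge0 => y _; rewrite lee_fin powR_ge0.
have -> : (2 * r) `^ ((m * n)%:R - n%:R / p0) = V ^+ m / V `^ p0^-1.
  rewrite gt0_powRD// powRN /V -powR_mulrn ?exprn_ge0 ?(ltW r20)//.
  by rewrite -[_ ^+ n]powR_mulrn ?(ltW r20)// -!powRrM mulnC natrM.
have morrey_ge : ((V `^ p0^-1)%:E * \prod_(j < m) (A j `^ (P j)^-1) <= morrey_norm P p0 f)%E.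
  apply: ereal_sup_ubound; exists ([tuple tnth x i - r | i < n], 2 * r) => //=.
  by rewrite -qballE volumeE ?(ltW r20).
rewrite EFinM -muleA; apply: (@le_trans _ _ ((V ^+ m)%:E * \prod_(j < m) (A j `^ (P j)^-1))%E).
  have := prode_cst V (fun j => A j `^ (P j)^-1)%E; rewrite card_ord => <-.
  apply: lee_prod_ge0 => j.
    by apply: integral_ge0 => y _.
  have := @average_powR_le _ _ R (lebesgue_Rn R n) (qball x r) V (P j) (fun y => `|f j y|).
  move=> /(_ (measurable_qball _ _)) h.
  apply: (@le_trans _ _ (V%:E * ((V^-1)%:E *
      \int[lebesgue_Rn R n]_(y in qball x r) `|f j y|%:E))%E).
    by rewrite muleA -EFinM divff ?mul1e// gt_eqF.
  apply: lee_wpmul2l; first by rewrite lee_fin ltW.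
  apply: h => //; first exact: measurableT_comp.
  by rewrite le_eqVlt; apply/orP; left; apply/eqP; exact: lebesgue_qball (ltW r0).
apply: lee_wpmul2l; first by rewrite lee_fin exprn_ge0// ltW.
apply: le_trans (lee_wpmul2l _ morrey_ge); last by rewrite lee_fin invr_ge0 powR_ge0.
by rewrite muleA -EFinM mulVf ?mul1e// gt_eqF// powR_gt0.
Qed.

End pointwise.

(** * Morrey norms and the estimate on a cube *)

Section borel_representatives.
Variables (R : realType) (m n : nat).
Local Notation Rn := (Rn R n).
Implicit Types f g : 'I_m -> Rn -> R.

(** By [ae_tnth] the integrands agree for almost every tuple, so the values agree at every [x]; this
    lets Borel representatives replace the functions whatever [mu] is. *)
Lemma eq_frac_integral_ae (alpha : R) f g x :
  (forall j, {ae lebesgue_Rn R n, forall y, f j y = g j y}) ->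
  frac_integral alpha f x = frac_integral alpha g x.
Proof.
move=> fg; apply: ae_eq_integral_any.
have : {ae tuple_measure (lebesgue_Rn R n) m, forall y, forall j, f j (tnth y j) = g j (tnth y j)}.
  apply: filter_forall => j; exact: (ae_tnth j (fg j)).
by apply: filterS => y fgy; under eq_bigr do rewrite fgy.
Qed.

Lemma eq_morrey_norm_ae (P : 'I_m -> R) (p0 : R) f g :
  (forall j, {ae lebesgue_Rn R n, forall y, f j y = g j y}) ->
  morrey_norm P p0 f = morrey_norm P p0 g.
Proof.
move=> fg; congr ereal_sup; apply: eq_imagel => -[a l] _ /=; congr (_ * _)%E.
apply: eq_bigr => j _; congr ((_ * _) `^ _)%E.
apply: ge0_ae_eq_integral_any => [y _|y _|]; rewrite ?lee_fin ?powR_ge0//.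
by have := fg j; apply: filterS => y -> _.
Qed.

End borel_representatives.

Section morrey.
Variables (R : realType) (m n : nat).
Local Notation Rn := (Rn R n).
Variables (P : 'I_m -> R) (p0 : R) (f : 'I_m -> Rn -> R).
Hypothesis mf : forall j, measurable_fun setT (f j).
Hypothesis P0 : forall j, 0 < P j.

Definition power_integral (j : 'I_m) (S : set Rn) : \bar R :=
  (\int[lebesgue_Rn R n]_(y in S) (`|f j y| `^ P j)%:E)%E.

Lemma power_integral_ge0 j S : (0 <= power_integral j S)%E.
Proof. by apply: integral_ge0 => y _; rewrite lee_fin powR_ge0. Qed.

Lemma measurable_power j : measurable_fun setT (fun y => (`|f j y| `^ P j)%:E).
Proof.
apply/measurable_EFinP; apply: (measurableT_comp (measurable_powR _)).
exact: measurableT_comp.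
Qed.

Lemma le_power_integral j S T : measurable S -> measurable T -> S `<=` T ->
  (power_integral j S <= power_integral j T)%E.
Proof.
move=> mS mT ST; apply: ge0_subset_integral => //.
exact: measurable_funTS (measurable_power j).
Qed.

Lemma cube_join (a b : Rn) (l k : R) : 0 < l -> 0 < k ->
  exists c, exists2 s, 0 < s & cube a l `<=` cube c s /\ cube b k `<=` cube c s.
Proof.
move=> l0 k0; exists [tuple Num.min (tnth a i) (tnth b i) | i < n].
pose D := \sum_(i < n) `|tnth a i - tnth b i|.
have D0 : 0 <= D by apply: sumr_ge0.
have DE i : `|tnth a i - tnth b i| <= D.
  by rewrite /D (bigD1 i)//= lerDl sumr_ge0.
exists (D + l + k); first by rewrite -addrA ltr_wpDl// addr_gt0.
split=> y h i; have := h i; have := DE i; rewrite tnth_mktuple !in_itv /= minEle;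
  case: ifP => ab; rewrite ler_norml => /andP[d1 d2] /andP[y1 y2]; move: ab; case: lerP => //; lra.
Qed.

Lemma prode_gt0_eqy (a : 'I_m -> \bar R) j : (forall i, 0 < a i)%E ->
  a j = +oo%E -> (\prod_i a i = +oo)%E.
Proof.
move=> a0 aj; rewrite (bigD1 j)//= aj gt0_mulye//.
by elim/big_ind : _ => // x y x0 y0; exact: mule_gt0.
Qed.

(** The Morrey norm only bounds a product, where a zero factor could hide an infinite one. As the
    norm is positive, all factors are positive on some cube, hence on a cube that also contains the
    given one; an infinite factor there would make the norm infinite. *)
Lemma power_integral_lty a l j : (0 < morrey_norm P p0 f < +oo)%E -> 0 < l ->
  (power_integral j (cube a l) < +oo)%E.
Proof.
move=> /andP[F0 Foo] l0.
have [[b k] /= k0 bk] : exists2 al : Rn * R, 0 < al.2 &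
    forall i, (0 < power_integral i (cube al.1 al.2))%E.
  apply: contrapT => H; move: F0; apply/negP; rewrite -leNgt.
  apply: ge_ereal_sup => _ [[b k] /= k0 <-].
  have [i] : exists i, ~ (0 < power_integral i (cube b k))%E.
    by apply/existsNP => Hi; apply: H; exists (b, k).
  move/negP; rewrite -leNgt => Ii.
  have Ii0 : power_integral i (cube b k) = 0%E.
    by apply/eqP; rewrite eq_le Ii power_integral_ge0.
  rewrite (bigD1 i)//= -/(power_integral i _) Ii0 mule0 poweR0r ?mul0e ?mule0//.
  by rewrite gt_eqF// invr_gt0.
have [c [s s0 [ac bc]]] := cube_join a b l0 k0.
apply: le_lt_trans (le_power_integral j _ _ ac) _; [exact: measurable_cube..|].
have V0 : 0 < volume c s by rewrite volumeE ?exprn_gt0// ltW.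
rewrite ltey; apply/eqP => Ioo; move: Foo; apply/negP; rewrite -leNgt.
apply: le_trans (ereal_sup_ubound _); last by exists (c, s); [exact: s0|reflexivity].
rewrite /= (@prode_gt0_eqy _ j) ?gt0_muley ?lte_fin ?powR_gt0 ?leey//.
- move=> i; apply: poweR_gt0; rewrite mule_gt0 ?lte_fin ?invr_gt0//.
  apply: lt_le_trans (bk i) _; apply: le_power_integral => //; exact: measurable_cube.
- rewrite -/(power_integral j _) Ioo gt0_muley ?lte_fin ?invr_gt0//.
  by rewrite poweRyr// gt_eqF// invr_gt0.
Qed.

End morrey.

Lemma measure_norm_cube (R : realType) (n : nat) (gamma M : R)
    (mu : {measure set (Rn R n) -> \bar R}) a l :
  measure_norm gamma mu = M%:E -> 0 < l -> (mu (cube a l) <= (M * l `^ gamma)%:E)%E.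
Proof.
move=> muM l0; have lg0 : 0 < l `^ gamma by rewrite powR_gt0.
have : (mu (cube a l) * ((l `^ gamma)^-1)%:E <= M%:E)%E.
  by rewrite -muM; apply: ereal_sup_ubound; exists (a, l).
by rewrite lee_pdivrMr ?EFinM.
Qed.

Lemma local_const_ge0 (R : realType) (m n : nat) (P : 'I_m -> R) (p beta : R) :
  (forall j, 1 < P j) -> 0 < p -> 0 < beta -> 0 <= local_const n P p beta.
Proof.
move=> P1 p0 b0; have P0 j : 0 < P j by exact: lt_trans (P1 j).
rewrite /local_const mulr_ge0// sumr_ge0// => j _; apply: trace_const_ge0 => //.
rewrite powR_ge0 /= powRN invf_le1 ?powR_gt0//.
suff : 1 `^ (beta * p / P j) <= 2 `^ (beta * p / P j) :> R by rewrite powR1.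
by apply: ge0_ler_powR; rewrite ?nnegrE ?divr_ge0 ?mulr_ge0
  ?(ltW b0) ?(ltW (P0 j)) ?(ltW p0) ?ler1n.
Qed.

Section cube_estimate.
Variables (R : realType) (m n : nat) (P : 'I_m -> R) (p p0 alpha beta : R).
Local Notation Rn := (Rn R n).
Local Notation kappa := (n%:R / p0).
Local Notation d := ((m * n)%:R : R).
Local Notation eps := (n%:R * (1 - p / p0)).
Local Notation theta := ((n%:R - beta * p0) / (n%:R - alpha * p0)).
Hypotheses (m0 : (0 < m)%N) (P1 : forall j, 1 < P j).
Hypotheses (pP : p^-1 = \sum_(j < m) (P j)^-1) (p_gt0 : 0 < p) (pp0 : p <= p0).
Hypotheses (ak : alpha < kappa) (b0 : 0 < beta) (ba : beta < alpha) (ad : alpha < d).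

Let p0_gt0 : 0 < p0. Proof. exact: lt_le_trans pp0. Qed.
Let P0 j : 0 < P j. Proof. exact: lt_trans (P1 j). Qed.
Let bk : beta < kappa. Proof. exact: lt_trans ba ak. Qed.
Let bd : beta < d. Proof. exact: lt_trans ba ad. Qed.

Variables (mu : {measure set Rn -> \bar R}) (M : R).
Hypothesis M0 : 0 <= M.
Hypothesis muM : forall (a : Rn) (l : R), 0 < l ->
  (mu (cube a l) <= (M * l `^ (n%:R - beta * p))%:E)%E.

Variables (f : 'I_m -> Rn -> R) (K : R).
Hypothesis mf : forall j, measurable_fun setT (f j).
Hypothesis K0 : 0 < K.
Hypothesis fK : morrey_norm P p0 f = K%:E.

(** Balls of radius at most [l] centred in the cube stay in the concentric cube [S] of side [3 * l],
    where [local_trace] applies; the Morrey norm on [S] then bounds the product of the [E j]. *)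
Lemma near_cube_bound (a : Rn) (l : R) : 0 < l ->
  exists H : Rn -> \bar R, [/\ measurable_fun setT H, (forall x, 0 <= H x)%E,
    (forall (x : Rn) (r : R), (0 < r)%R -> (r <= l)%R -> cube a l x ->
      ball_prod f x r <= ((24 * r) `^ (d - beta))%:E * H x `^ p^-1)%E &
    (\int[mu]_x H x <=
      (local_const n P p beta * M * (K `^ p * (3 * l) `^ eps))%:E)%E].
Proof.
move=> l0; pose a' : Rn := [tuple tnth a i - l | i < n].
have l30 : 0 < 3 * l by rewrite mulr_gt0.
pose S := cube a' (3 * l).
have qS x r : cube a l x -> r <= l -> qball x r `<=` S.
  move=> ax rl y qy i; have := ax i; have := qy i.
  rewrite tnth_mktuple !in_itv /= ler_norml => /andP[h1 h2] /andP[h3 h4]; lra.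
have lc0 : 0 <= local_const n P p beta by exact: local_const_ge0.
pose E j := fine (power_integral P f j S).
have EE j : power_integral P f j S = (E j)%:E.
  rewrite fineK// ge0_fin_numE ?power_integral_ge0//.
  by apply: (@power_integral_lty _ _ _ _ p0) => //; rewrite fK lte_fin K0 ltry.
have E0 j : 0 <= E j by rewrite fine_ge0// power_integral_ge0.
(* If some [E j] is 0 it cannot be divided by, but then [f j] vanishes almost everywhere on [S], the
   ball products are 0 and [H = 0] serves. *)
have [Epos|] := pselect (forall j, 0 < E j); last first.
  move=> /existsNP[j /negP]; rewrite -leNgt => Ej.
  have {}Ej : power_integral P f j S = 0%E.
    by rewrite EE; congr EFin; apply/eqP; rewrite eq_le Ej E0.
  exists (cst 0%E); split => //.
  - move=> x r r0 rl ax; rewrite [leRHS](_ : _ = 0)%E; last first.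
      by rewrite poweR0r ?mule0// gt_eqF// invr_gt0.
    rewrite /ball_prod (bigD1 j)//= [X in (X * _)%E](_ : _ = 0)%E ?mul0e//.
    have -> : (0 = \int[lebesgue_Rn R n]_(y in qball x r) (cst 0 y))%E by rewrite integral0.
    have mS : measurable S by exact: measurable_cube.
    apply: ge0_ae_eq_integral_any => //.
    have h : ae_eq (lebesgue_Rn R n) S (fun y => (`|f j y| `^ P j)%:E) (cst 0%E).
      apply/ae_eq_integral_abs => //.
        exact: measurable_funTS (measurable_power P mf j).
      rewrite -[RHS]Ej; apply: eq_integral => y _.
      by rewrite gee0_abs// lee_fin powR_ge0.
    apply: filterS h => y h qy; have := h (qS x r ax rl y qy).
    by move=> /eqP; rewrite eqe => /eqP e; congr EFin; exact: powR_eq0_eq0 e.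
  - rewrite integral0 lee_fin; apply: mulr_ge0; first exact: mulr_ge0.
    by rewrite mulr_ge0 ?powR_ge0.
have mnf j : measurable_fun setT (fun y => `|f j y|) by exact: measurableT_comp.
have [H [mH H0 Hle Hint]] := @local_trace R m n P p beta M l mu
  (fun j y => `|f j y|) S E m0 P1 pP p_gt0 b0 (ltW bd) M0 l0 muM
  (measurable_cube _ _) mnf
  (fun j x => normr_ge0 _) Epos EE.
exists H; split => //.
  by move=> x r r0 rl ax; apply: Hle => //; exact: qS.
apply: (le_trans Hint); rewrite lee_fin.
apply: ler_wpM2l; first exact: mulr_ge0.
set V := (3 * l) ^+ n; have V0 : 0 < V by rewrite exprn_gt0.
have hK : V `^ p0^-1 * \prod_(j < m) ((V^-1 * E j) `^ (P j)^-1) <= K.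
  rewrite -lee_fin -fK EFinM -prodEFin; apply: ereal_sup_ubound.
  exists (a', 3 * l) => //=; rewrite volumeE ?(ltW l30)//; congr (_ * _)%E.
  apply: eq_bigr => j _; rewrite -poweR_EFin EFinM; congr ((_ * _) `^ _)%E.
  exact: EE.
have VE : (3 * l) `^ eps = V `^ (1 - p / p0).
  by rewrite powRrM powR_mulrn ?(ltW l30).
rewrite VE.
(* The powers of [V] cancel: the factors [V^-1] contribute the total exponent -1, since the
   [p / P j] add up to 1. *)
have -> : \prod_(j < m) E j `^ (p / P j) =
   (V `^ p0^-1 * \prod_(j < m) ((V^-1 * E j) `^ (P j)^-1)) `^ p * V `^ (1 - p / p0).
  rewrite powRM ?powR_ge0//; last by apply: prodr_ge0 => j _; rewrite powR_ge0.
  rewrite powR_prod; last by move=> j; rewrite powR_ge0.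
  under [in RHS]eq_bigr => j _.
    rewrite -powRrM powRM ?invr_ge0 ?(ltW V0)// (mulrC _ p).
    rewrite -[V^-1]powR_inv1 ?(ltW V0)// -powRrM.
    over.
  rewrite big_split /= -powR_sum// -mulr_sumr -mulr_sumr -pP divff ?gt_eqF// mulr1.
  rewrite -powRrM mulrC mulrA mulrA -!gt0_powRD//.
  have -> : 1 - p / p0 + p0^-1 * p + -1 = 0 by rewrite mulrC; ring.
  by rewrite powRr0 mul1r.
rewrite ler_wpM2r ?powR_ge0//; apply: ge0_ler_powR; rewrite ?nnegrE ?(ltW p_gt0) ?(ltW K0)//.
by rewrite mulr_ge0 ?powR_ge0// prodr_ge0// => j _; rewrite powR_ge0.
Qed.

(** Hedberg's constant, then the constants of the two ball bounds, all to the powers they get in the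
    estimate of the q-th power; in the last factor, the summand 1 accounts for the radii above the
    side of the cube. *)
Definition cube_const : R :=
  hedberg_const m n alpha beta kappa `^ (theta * p) *
  ((24 `^ (d - beta) + 2 `^ (d - kappa)) `^ p *
   (2 `^ (d - kappa)) `^ (theta * p - p)) *
  (local_const n P p beta * 3 `^ eps + 1).

(** [H2 = H + Hc] stands in for the p-th power of the fractional maximal function: [H] serves the
    radii up to [l], [Hc] those above. In Hedberg's inequality [H2] has the exponent 1/(theta p), so
    the q-th power is linear in [H2] and can be integrated. *)
Lemma frac_integral_cube (a : Rn) (l : R) : 0 < l ->
  (\int[mu]_(x in cube a l) (`|frac_integral alpha f x| `^ (theta * p)) <=
   (cube_const * M * l `^ eps * K `^ (theta * p))%:E)%E.
Proof.
move=> l0; have [H [mH H0 Hle Hint]] := near_cube_bound a l0.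
set q := theta * p.
have den0 : 0 < n%:R - alpha * p0 by rewrite subr_gt0 -ltr_pdivlMr.
have theta1 : 1 < theta.
  by rewrite ltr_pdivlMr// mul1r ltrD2l ltrN2 ltr_pM2r.
have theta0 : 0 < theta by exact: lt_trans theta1.
have q0 : 0 < q by rewrite mulr_gt0.
have thetaE : (kappa - alpha) / (kappa - beta) = theta^-1.
  have : n%:R - beta * p0 != 0.
    by rewrite gt_eqF//; move: theta0; rewrite pmulr_lgt0// invr_gt0.
  move=> h1; have h2 : n%:R - alpha * p0 != 0 by rewrite gt_eqF.
  have h3 : p0 != 0 by rewrite gt_eqF.
  by field; rewrite h1 h2 h3.
have thetaE' : (alpha - beta) / (kappa - beta) = 1 - theta^-1.
  have kb : kappa - beta != 0 by rewrite gt_eqF// subr_gt0.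
  have kab : kappa - beta = (alpha - beta) + (kappa - alpha) by ring.
  have h : (alpha - beta) / (kappa - beta) + (kappa - alpha) / (kappa - beta) = 1.
    by rewrite -mulrDl -kab divff.
  rewrite -thetaE; apply: (addIr ((kappa - alpha) / (kappa - beta))).
  by rewrite h subrK.
set c2 := 24 `^ (d - beta) + 2 `^ (d - kappa).
have c20 : 0 < c2 by rewrite addr_gt0 ?powR_gt0.
have k20 : 0 < 2 `^ (d - kappa) by rewrite powR_gt0.
set hed := hedberg_const m n alpha beta kappa.
have hed0 : 0 < hed by exact: hedberg_const_gt0.
(* For [r > l] the Morrey bound on the ball is at most 2^(d - kappa) l^(beta - kappa) K r^(d -
   beta), because beta - kappa is negative. *)
pose Hc := (l `^ (beta - kappa) * K) `^ p.
have lK0 : 0 < l `^ (beta - kappa) * K by rewrite mulr_gt0 ?powR_gt0.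
have Hc0 : 0 < Hc by rewrite powR_gt0.
pose H2 x := (H x + Hc%:E)%E.
have H20 x : (0 <= H2 x)%E by rewrite adde_ge0// lee_fin ltW.
have poweR_le (s : R) (u v : \bar R) : 0 <= s -> (0 <= u)%E -> (u <= v)%E ->
    (u `^ s <= v `^ s)%E.
  move=> s0 u0 uv; apply: gt0_ler_poweR => //; rewrite in_itv /= leey andbT//.
  exact: le_trans uv.
have pi0 : 0 <= p^-1 by rewrite invr_ge0 ltW.
have ball_le x r : cube a l x -> 0 < r ->
    (ball_prod f x r <= (c2 * r `^ (d - beta))%:E * H2 x `^ p^-1)%E.
  move=> ax r0; have [rl|lr] := leP r l.
    apply: (le_trans (Hle x r r0 rl ax)); apply: lee_pmul.
    - by rewrite lee_fin powR_ge0.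
    - exact: poweR_ge0.
    - by rewrite lee_fin powRM ?(ltW r0)// ler_wpM2r ?powR_ge0// lerDl ltW.
    - by apply: poweR_le => //; rewrite leeDl// lee_fin ltW.
  apply: (le_trans (ball_prod_le_morrey p0 x mf P1 r0)); rewrite fK.
  apply: (@le_trans _ _ ((c2 * r `^ (d - beta))%:E * (Hc `^ p^-1)%:E)%E); last first.
    rewrite -poweR_EFin; apply: lee_wpmul2l.
      by rewrite lee_fin mulr_ge0 ?powR_ge0 ?(ltW c20).
    apply: poweR_le => //; first by rewrite lee_fin ltW.
    by rewrite leeDr.
  rewrite -!EFinM lee_fin /Hc -powRrM divff ?gt_eqF// powRr1 ?(ltW lK0)//.
  rewrite (powRM _ _ (ltW r0))// mulrA ler_wpM2r ?(ltW K0)// -[leRHS]mulrA.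
  apply: ler_pM; rewrite ?powR_ge0//; first by rewrite lerDr powR_ge0.
  have -> : d - kappa = (d - beta) + - (kappa - beta) by ring.
  rewrite gt0_powRD// ler_wpM2l ?powR_ge0// -(opprB kappa beta) !powRN.
  rewrite lef_pV2 ?posrE ?powR_gt0//; apply: ge0_ler_powR;
    rewrite ?nnegrE ?subr_ge0 ?(ltW bk) ?(ltW l0) ?(ltW r0) ?(ltW lr)//.
pose C3 := hed `^ q * (c2 `^ p * (2 `^ (d - kappa)) `^ (q - p)).
have C30 : 0 < C3 by rewrite !mulr_gt0 ?powR_gt0.
have CK0 : 0 < C3 * K `^ (q - p) by rewrite mulr_gt0 ?powR_gt0.
have pointwise x : cube a l x ->
    (`|frac_integral alpha f x| `^ q <= (C3 * K `^ (q - p))%:E * H2 x)%E.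
  move=> ax; have [Hoo|Hfin] := eqVneq (H2 x) +oo%E.
    by rewrite Hoo gt0_muley ?lte_fin ?leey.
  pose h := fine (H2 x).
  have H2E : H2 x = h%:E by rewrite /h fineK// ge0_fin_numE// ltey.
  (* The summand [Hc] keeps [h] positive, as [frac_integral_hedberg] requires. *)
  have h0 : 0 < h.
    by rewrite -lte_fin -H2E (lt_le_trans _ (leeDr _ (H0 x)))// lte_fin.
  have N0 : 0 < c2 * h `^ p^-1 by rewrite mulr_gt0 ?powR_gt0.
  have K'0 : 0 < 2 `^ (d - kappa) * K by rewrite mulr_gt0.
  have := @frac_integral_hedberg R m n alpha beta kappa _ _ f x mf ad ba ak N0 K'0.
  rewrite thetaE thetaE' => hedb.
  have {}hedb : (`|frac_integral alpha f x| <= (hed * ((c2 * h `^ p^-1) `^ theta^-1 *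
      (2 `^ (d - kappa) * K) `^ (1 - theta^-1)))%:E)%E.
    apply: hedb => r r0.
      by apply: (le_trans (ball_le x r ax r0)); rewrite H2E -EFinM lee_fin mulrAC.
    apply: (le_trans (ball_prod_le_morrey p0 x mf P1 r0)); rewrite fK -EFinM lee_fin.
    by rewrite powRM ?(ltW r0)// mulrAC.
  apply: (le_trans (poweR_le q _ _ (ltW q0) (abse_ge0 _) hedb)).
  rewrite poweR_EFin H2E -EFinM lee_fin le_eqVlt; apply/orP; left; apply/eqP.
  rewrite powRM ?(ltW hed0) ?mulr_ge0 ?powR_ge0// /C3 -!mulrA; congr (_ * _).
  rewrite powRM ?powR_ge0// -!powRrM.
  have -> : theta^-1 * q = p by rewrite /q mulrA mulVf ?mul1r// gt_eqF.
  have -> : (1 - theta^-1) * q = q - p.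
    by rewrite mulrBl mul1r /q mulrA mulVf ?mul1r// gt_eqF.
  rewrite powRM ?powR_ge0 ?(ltW c20)// -powRrM mulVf ?gt_eqF// powRr1 ?(ltW h0)//.
  by rewrite powRM ?powR_ge0 ?(ltW K0)// -powRrM; ring.
have mcube : measurable (cube a l) by exact: measurable_cube.
have mHc : measurable_fun (cube a l) H by exact: measurable_funTS.
apply: (@le_trans _ _ (\int[mu]_(x in cube a l) ((C3 * K `^ (q - p))%:E * H2 x))%E).
  by apply: ge0_le_integral_any => [x _|x ax]; [exact: poweR_ge0|exact: pointwise].
rewrite ge0_integralZl_EFin ?(ltW CK0)//; last exact: emeasurable_funD.
rewrite ge0_integralD//; last by move=> x _; rewrite lee_fin ltW.
rewrite integral_cst//.
apply: (@le_trans _ _ ((C3 * K `^ (q - p))%:E *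
   ((local_const n P p beta * M * (K `^ p * (3 * l) `^ eps))%:E +
    (Hc * (M * l `^ (n%:R - beta * p)))%:E))%E).
  apply: lee_wpmul2l; first by rewrite lee_fin ltW.
  apply: leeD.
    by apply: le_trans Hint; apply: ge0_subset_integral.
  by rewrite EFinM; apply: lee_wpmul2l; [rewrite lee_fin ltW|exact: muM].
rewrite -EFinD -EFinM lee_fin le_eqVlt; apply/orP; left; apply/eqP.
(* The constant part scales like the other one: p (beta - n/p0) + n - beta p = n (1 - p/p0). *)
have HcE : Hc * l `^ (n%:R - beta * p) = K `^ p * l `^ eps.
  rewrite /Hc powRM ?powR_ge0 ?(ltW K0)// -powRrM mulrAC -gt0_powRD// mulrC.
  by congr (_ * _ `^ _); field; rewrite gt_eqF.
have KE : K `^ q = K `^ (q - p) * K `^ p by rewrite -gt0_powRD// subrK.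
rewrite (mulrCA Hc) HcE (powRM _ _ (ltW l0))// KE /cube_const -/q -/c2 -/hed -/C3.
ring.
Qed.

End cube_estimate.

(** * From cubes to norms *)

Theorem theorem1p1 (R : realType) (m n : nat) (P : 'I_m -> R)
    (p p0 alpha beta : R) :
  (0 < m)%N -> (0 < n)%N ->
  (forall j, 1 < P j) ->
  p^-1 = \sum_(j < m) (P j)^-1 ->
  1 < p -> p <= p0 -> p0 < n%:R / alpha ->
  0 < beta -> beta < alpha -> alpha < (m * n)%:R ->
  let theta := (n%:R - beta * p0) / (n%:R - alpha * p0) in
  let q := theta * p in
  let q0 := theta * p0 in
  exists2 C : R, 0 < C &
    forall mu : {measure set (Rn R n) -> \bar R}, radon mu ->
    forall f : 'I_m -> Rn R n -> R, morrey_space P p0 f ->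
      ae_measurable mu (frac_integral alpha f) /\
      (radon_morrey_norm mu q q0 (frac_integral alpha f) <=
       C%:E * measure_norm (n%:R - beta * p) mu `^ q^-1 * morrey_norm P p0 f)%E.
Proof.
move=> m0 n0 P1 pP p1 pp0 p0a b0 ba ad theta q q0.
have p_gt0 : 0 < p by exact: lt_trans p1.
have p0_gt0 : 0 < p0 by exact: lt_le_trans pp0.
have a0 : 0 < alpha by exact: lt_trans ba.
have ak : alpha < n%:R / p0 by rewrite ltr_pdivlMr// mulrC -ltr_pdivlMr.
have den0 : 0 < n%:R - alpha * p0 by rewrite subr_gt0 -ltr_pdivlMr.
have theta0 : 0 < theta.
  rewrite divr_gt0// (lt_trans den0)// ltrD2l ltrN2 ltr_pM2r//.
have q_gt0 : 0 < q by rewrite mulr_gt0.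
have [C4 C4E C40] : exists2 C4, cube_const n P p p0 alpha beta = C4 & 0 < C4.
  exists (cube_const n P p p0 alpha beta) => //.
  rewrite /cube_const; apply: mulr_gt0; last first.
    by rewrite ltr_wpDl// mulr_ge0 ?powR_ge0//; exact: local_const_ge0.
  apply: mulr_gt0; first by rewrite powR_gt0//; exact: hedberg_const_gt0.
  by rewrite mulr_gt0 ?powR_gt0// addr_gt0 ?powR_gt0.
(* The estimate on a cube concerns q-th powers, so its constant enters with the power 1/q. *)
exists (C4 `^ q^-1); first by rewrite powR_gt0.
move=> mu _ f [/all_and2 [fae _] Foo].
have /choice[g gP] j : exists g : Rn R n -> R,
    measurable_fun setT g /\ {ae lebesgue_Rn R n, forall y, f j y = g y}.
  by have [g mg fg] := fae j; exists g.
have mg j : measurable_fun setT (g j) by have [] := gP j.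
have fg j : {ae lebesgue_Rn R n, forall y, f j y = g j y} by have [] := gP j.
have -> : frac_integral alpha f = frac_integral alpha g.
  by apply/funext => x; exact: eq_frac_integral_ae.
rewrite (eq_morrey_norm_ae P p0 fg) in Foo *.
split.
  exists (frac_integral alpha g); first exact: measurable_frac_integral.
  exact: aeW.
have F0 : (0 <= morrey_norm P p0 g)%E.
  apply: le_trans (ereal_sup_ubound _); last by exists (point, 1); [exact: ltr01|reflexivity].
  by rewrite mule_ge0 ?lee_fin ?powR_ge0//; apply: prode_ge0 => j _; exact: poweR_ge0.
have gamma0 : (0 <= measure_norm (n%:R - beta * p) mu)%E.
  apply: le_trans (ereal_sup_ubound _); last by exists (point, 1); [exact: ltr01|reflexivity].
  by rewrite mule_ge0// lee_fin invr_ge0 powR_ge0.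
(* The right-hand side is then 0 even when the norm of [mu] is infinite, so the fractional integral
   has to vanish at every point. *)
have [Fz|Fnz] := eqVneq (morrey_norm P p0 g) 0%E.
  have I0 x : frac_integral alpha g x = 0%E.
    apply: frac_integral_eq0 => // r r0; apply/eqP; rewrite eq_le ball_prod_ge0 andbT.
    by apply: (le_trans (ball_prod_le_morrey p0 x mg P1 r0)); rewrite Fz mule0.
  rewrite Fz mule0; apply: ge_ereal_sup => _ [[a l] /= l0 <-].
  rewrite integral0_eq ?poweR0r ?mule0 ?gt_eqF ?invr_gt0// => x _.
  by rewrite I0 abse0 poweR0r// gt_eqF.
have Fpos : (0 < morrey_norm P p0 g)%E by rewrite lt_neqAle eq_sym Fnz.
have [Moo|Mfin] := eqVneq (measure_norm (n%:R - beta * p) mu) +oo%E.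
  rewrite Moo poweRyr; last by rewrite gt_eqF// invr_gt0.
  by rewrite gt0_muley ?lte_fin ?powR_gt0// gt0_mulye ?leey.
pose M := fine (measure_norm (n%:R - beta * p) mu).
have ME : measure_norm (n%:R - beta * p) mu = M%:E by rewrite /M fineK// ge0_fin_numE// ltey.
have M0 : 0 <= M by exact: fine_ge0.
pose K := fine (morrey_norm P p0 g).
have KE : morrey_norm P p0 g = K%:E by rewrite /K fineK// ge0_fin_numE.
have K0 : 0 < K by rewrite -lte_fin -KE.
rewrite ME KE poweR_EFin -!EFinM; apply: ge_ereal_sup => _ [[a l] /= l0 <-].
have est := frac_integral_cube m0 P1 pP p_gt0 pp0 ak b0 ba ad M0
  (fun a' l' => @measure_norm_cube _ _ _ _ _ a' l' ME) mg K0 KE a l0.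
rewrite C4E in est.
set I := (\int[mu]_(x in _) _)%E in est *.
have I0 : (0 <= I)%E by apply: integral_ge0 => x _; exact: poweR_ge0.
apply: (@le_trans _ _ ((volume a l `^ (q0^-1 - q^-1))%:E *
   ((C4 * M * l `^ (n%:R * (1 - p / p0)) * K `^ q)%:E `^ q^-1))%E).
  apply: lee_wpmul2l; first by rewrite lee_fin powR_ge0.
  apply: gt0_ler_poweR; rewrite ?invr_ge0 ?(ltW q_gt0)// in_itv /= leey andbT//.
  exact: le_trans est.
rewrite poweR_EFin -EFinM lee_fin volumeE ?(ltW l0)//.
rewrite le_eqVlt; apply/orP; left; apply/eqP.
rewrite !powRM ?mulr_ge0 ?powR_ge0 ?(ltW C40)//.
rewrite -!powRrM divff ?gt_eqF// powRr1 ?(ltW K0)//.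
(* Because q/q0 = p/p0, the volume factor of the norm cancels exactly the power of [l] in the
   estimate on the cube. *)
have -> : (l ^+ n) `^ (q0^-1 - q^-1) = l `^ (- (n%:R * (1 - p / p0) * q^-1)).
  rewrite -powR_mulrn ?(ltW l0)// -powRrM; congr (_ `^ _).
  by rewrite /q0 /q; field; rewrite !gt_eqF.
have le0 : l `^ (n%:R * (1 - p / p0) * q^-1) != 0 by rewrite gt_eqF ?powR_gt0.
by rewrite powRN; field.
Qed.
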